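(* For every prime $p$, every prime $\ell$ dividing $\tau(p^4)$ satisfies either $\ell = p$ or $\ell \equiv 0, 1, 4 \pmod 5$.
   Context: $\tau(n)$ denotes the Ramanujan tau-function, defined by $\sum_{n=1}^\infty \tau(n) q^n = q \prod_{n=1}^\infty (1-q^n)^{24}$. *)

(* Defs.v *)
From mathcomp Require Import all_boot all_order all_algebra.

Set Implicit Arguments.
Unset Strict Implicit.
Unset Printing Implicit Defensive.

Import GRing.Theory.
Local Open Scope ring_scope.

Definition tau_prod (N : nat) : {poly int} :=
  'X * \prod_(1 <= k < N.+1) (1 - 'X^k) ^+ 24.

(* The coefficient of q^n in q * \prod_(k >= 1) (1 - q^k)^24: the factors with
   k > n are congruent to 1 modulo q^(n+1), so the product can be cut at k = n;
   see tau_prodE. *)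
Definition tau (n : nat) : int := (tau_prod n)`_n.

Lemma tau_prodE (n N : nat) : (n <= N)%N -> (tau_prod N)`_n = tau n.
Proof.
have coef_cong (P Q : {poly int}) m : (n < m)%N -> (P * (1 - 'X^m * Q))`_n = P`_n.
  by move=> ltnm; rewrite mulrBr mulr1 coefB mulrCA coefXnM ltnm subr0.
have pow_cong m j : exists Q : {poly int}, (1 - 'X^m) ^+ j = 1 - 'X^m * Q.
  elim: j => [|j [Q IH]]; first by exists 0; rewrite mulr0 subr0.
  exists (Q + (1 - 'X^m * Q)).
  by rewrite exprS IH mulrBl mul1r [in RHS]mulrDr opprD addrA.
move=> /subnK <-; elim: (N - n)%N => [//|d IH].
rewrite addSn /tau_prod big_nat_recr //= mulrA.
have [Q ->] := pow_cong (d + n).+1 24.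
by rewrite coef_cong ?ltnS ?leq_addl.
Qed.

(* Main.v *)
Require Import Defs.
From mathcomp Require Import all_boot all_order all_algebra all_fingroup all_solvable.
From mathcomp Require Import ring zify.

(** The theorem follows from Mordell's relation
      tau p * tau n = tau (p n) + p^11 tau (n / p)
    (the last term being present when p divides n), which gives
      tau (p^4) = x^2 - 3 x y + y^2   with x = tau(p)^2 and y = p^11.
    If a prime l <> p divides this value, then g = x / y - 2 is a root of
    g^2 + g - 1 in 'F_l, so that X^2 - g X + 1 divides X^4 + X^3 + X^2 + X + 1
    and its companion matrix has order 5 in GL_2(l). Hence 5 divides
    l (l - 1)^2 (l + 1).

    Mordell's relation is usually deduced from the fact that Delta spans a
    space of modular forms. Here all of it is done with finite sums and
    polynomial identities: modular forms are replaced by their periods.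

    - Euclid on quadruples. Let a d + b c = n with a, b, c, d > 0. One step of
      the subtractive Euclidean algorithm on (c, d), compensated on (a, b) so
      that a d + b c is preserved, is a bijection from the quadruples with
      c <> d to those with a <> b. Summing a function minus its shift by this
      step therefore leaves only the terms with c = d or a = b
      (quad_sum_telescope). Sums of polynomials in a and b being convolutions
      of divisor sums, this proves E4^2 = E8 and Ramanujan's differential
      equations for E4 and E6. These show that E4^3 - E6^2 satisfies the
      differential equation theta F = E2 F of Delta, which gives tau in terms
      of convolutions (tau_eisenstein).

    - Modular symbols. A modular symbol is a function f u v x of three integer
      vectors that is additive along the path from u to v, invariant under
      GL_2(Z), and a homogeneous polynomial of degree 10 in x. It is
      determined by its period f e1 e2 (ms_e12), and the Euclidean algorithm
      builds one from any even period polynomial (modsym_symbol). The periods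
      form a space with basis even12, eis12 (period_span). Hecke operators act
      on modular symbols (modsym_hecke) and satisfy the expected relation
      (hecke_hecke), by elementary bookkeeping with Hermite normal forms.

    - The link. Telescoping the function
      f (-c, d) e1 (a, b) + (a polynomial in a and b) over quadruples
      evaluates hecke n f e1 e2 e1 by convolutions (hecke_quad_sum). For the
      symbol of delta12 = 691 even12 - 36 eis12, which is the even period
      polynomial of Delta up to a scalar, the result is - 36 tau n
      (hecke_delta12_tau).

    It remains to see that delta12 is an eigenvector of the p-th Hecke operator
    (hecke_delta12_eigen). This operator commutes with the second one, which
    multiplies delta12 by - 24 and eis12 by 2049; as these differ, the image of
    delta12 has no component on eis12. Its eigenvalue can only be tau p, and
    evaluating hecke n (hecke p) on delta12 gives Mordell's relation. *)

Set Implicit Arguments.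
Unset Strict Implicit.
Unset Printing Implicit Defensive.

Import Order.TTheory GRing.Theory Num.Theory.
Local Open Scope ring_scope.

(** * Elements of order five in GL_2 of a prime field *)

Definition mx2 (R : nzRingType) (a b c d : R) : 'M[R]_2 :=
  \matrix_(i, j) if i == 0 then (if j == 0 then a else b)
                 else (if j == 0 then c else d).

Lemma mul_mx2 (R : nzRingType) (a b c d a' b' c' d' : R) :
  mx2 a b c d *m mx2 a' b' c' d' =
  mx2 (a * a' + b * c') (a * b' + b * d') (c * a' + d * c') (c * b' + d * d').
Proof.
by apply/matrixP=> i j; rewrite !mxE !big_ord_recl big_ord0 !mxE addr0 /=;
  case: (i == 0); case: (j == 0).
Qed.

(** The matrix M below is the companion matrix of X^2 - g X + 1, a factor of
    X^4 + X^3 + X^2 + X + 1 because g^2 + g = 1. It has order 5, and 5 divides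
    the order l (l - 1)^2 (l + 1) of GL_2(l) exactly when l is 0, 1 or 4
    modulo 5. *)
Lemma golden_root_mod5 (l : nat) (g : 'F_l) :
  prime l -> g ^+ 2 + g - 1 = 0 ->
  l = 0 %[mod 5] \/ l = 1 %[mod 5] \/ l = 4 %[mod 5].
Proof.
move=> l_pr g_root.
have g2 : g * g = 1 - g by rewrite -[LHS]subr0 -g_root; ring.
pose M := mx2 g (-1) 1 0.
have M1 : mx2 1 0 0 1 = 1%:M :> 'M['F_l]_2.
  by apply/matrixP=> [[[|[|//]] ?] [[|[|//]] ?]]; rewrite !mxE.
have M5 : M *m M *m (M *m M) *m M = 1%:M.
  rewrite !mul_mx2 -M1.
  by congr mx2; ring: g2.
have unitM : M \in unitmx.
  by have [] := mulmx1_unit M5.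
have cardF : #|'F_l| = l by rewrite card_Fp.
pose x : {'GL_2['F_l]} := Sub M unitM.
have x5 : (x ^+ 5 = 1)%g.
  rewrite !expgS expg0 mulg1; apply: val_inj; rewrite /= -[RHS]M5.
  by rewrite !mulmxE !mulrA.
have x1 : x != 1%g.
  apply/eqP=> /(congr1 val) /= /matrixP /(_ 1 0).
  by rewrite !mxE /= => /eqP; rewrite oner_eq0.
have ox : #[x]%g = 5%N by apply: nt_prime_order => //.
have: (5 %| #|('GL_2['F_l])%g|)%N by rewrite -ox order_dvdG ?inE.
rewrite card_GL_2 cardF.
have := prime_gt1 l_pr.
rewrite !Euclid_dvdM //.
by lia.
Qed.

Lemma dvdz_intr_Fp (l : nat) (z : int) :
  prime l -> (l%:Z %| z)%Z = (z%:~R == 0 :> 'F_l).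
Proof.
move=> l_pr; rewrite dvdzE /=.
have -> : (z%:~R == 0 :> 'F_l) = (`|z|%N%:R == 0 :> 'F_l).
  by case: z => n; rewrite // NegzE mulrNz oppr_eq0.
by rewrite -(dvdn_pcharf (pchar_Fp l_pr)).
Qed.

(** With g = x / y - 2, the form divided by y^2 is g^2 + g - 1. *)
Lemma dvd_quadratic_form_mod5 (l : nat) (x y : int) :
  prime l -> ~~ (l%:Z %| y)%Z ->
  (l%:Z %| x ^+ 2 - 3 * x * y + y ^+ 2)%Z ->
  l = 0 %[mod 5] \/ l = 1 %[mod 5] \/ l = 4 %[mod 5].
Proof.
move=> l_pr; rewrite !dvdz_intr_Fp // => y0 /eqP.
rewrite !(rmorphD, rmorphN, rmorphM, rmorphXn) /= => root_xy.
set X : 'F_l := x%:~R in root_xy *; set Y : 'F_l := y%:~R in y0 root_xy *.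
apply: (@golden_root_mod5 l (X / Y - 2)) => //.
have -> : (X / Y - 2) ^+ 2 + (X / Y - 2) - 1
        = (X ^+ 2 - 3 * X * Y + Y ^+ 2) / Y ^+ 2 by field.
by rewrite root_xy mul0r.
Qed.

(** * Sums over quadruples and divisor sums *)

(** Change of variable in a filtered sum, with both directions of the bijection
    explicit: the index sets below are duplicate-free lists known through their
    membership predicates. *)
Lemma reindex_seq (R : nmodType) (I J : eqType) (r : seq I) (s : seq J)
    (A : pred I) (B : pred J) (F : I -> J) (G : J -> I) (k : J -> R) :
    uniq r -> uniq s ->
    (forall i, i \in r -> A i -> [/\ F i \in s, B (F i) & G (F i) = i]) ->
    (forall j, j \in s -> B j -> [/\ G j \in r, A (G j) & F (G j) = j]) ->
  \sum_(i <- r | A i) k (F i) = \sum_(j <- s | B j) k j.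
Proof.
move=> Ur Us FP GP; rewrite -!(big_filter _ A) -(big_filter _ B) -(big_map F xpredT).
apply/perm_big/uniq_perm; first 1 last.
- exact: filter_uniq.
- move=> j; rewrite mem_filter; apply/mapP/andP=> [[i]|[Bj sj]].
    by rewrite mem_filter => /andP[Ai ri] ->; have [] := FP i ri Ai.
  have [rG AG FG] := GP j sj Bj; exists (G j) => //.
  by rewrite mem_filter AG.
rewrite map_inj_in_uniq ?filter_uniq // => i i'.
rewrite !mem_filter => /andP[Ai ri] /andP[Ai' ri'] eqF.
have [_ _ <-] := FP i ri Ai; rewrite eqF.
by have [_ _ ->] := FP i' ri' Ai'.
Qed.

Definition dpairs (S T : eqType) (s : seq S) (t : S -> seq T) : seq (S * T) :=
  [seq (x, y) | x <- s, y <- t x].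

Lemma mem_dpairs (S T : eqType) (s : seq S) (t : S -> seq T) x y :
  ((x, y) \in dpairs s t) = (x \in s) && (y \in t x).
Proof.
apply/allpairsPdep/andP=> [[x' [y' [sx ty [-> ->]]]] //|[sx ty]].
by exists x, y.
Qed.

Lemma uniq_dpairs (S T : eqType) (s : seq S) (t : S -> seq T) :
  uniq s -> (forall x, uniq (t x)) -> uniq (dpairs s t).
Proof.
move=> Us Ut; apply: allpairs_uniq_dep => // [[x y] [x' y']] _ _ /= [-> ->].
by [].
Qed.

Lemma big_dpairs (R : nmodType) (S T : eqType) (s : seq S) (t : S -> seq T)
    (k : S -> T -> R) :
  \sum_(p <- dpairs s t) k p.1 p.2 = \sum_(x <- s) \sum_(y <- t x) k x y.
Proof. by rewrite /dpairs big_allpairs_dep. Qed.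

(** A quadruple is stored as ((a, b), (c, d)), the equation being
    a d + b c = n. *)
Definition quads (n : nat) : seq ((nat * nat) * (nat * nat)) :=
  let box := dpairs (iota 1 n) (fun=> iota 1 n) in
  [seq q <- dpairs box (fun=> box) | q.1.1 * q.2.2 + q.1.2 * q.2.1 == n]%N.

Lemma uniq_quads n : uniq (quads n).
Proof.
rewrite filter_uniq // !uniq_dpairs // => *; rewrite ?uniq_dpairs // => *.
all: by rewrite iota_uniq.
Qed.

Lemma mem_quads n a b c d :
  (((a, b), (c, d)) \in quads n)
    = [&& 0 < a, 0 < b, 0 < c, 0 < d & a * d + b * c == n]%N.
Proof.
rewrite mem_filter !mem_dpairs !mem_iota /=.
apply/idP/idP; first by lia.
case/and5P=> a0 b0 c0 d0 /eqP <-; nia.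
Qed.

Lemma quads_split n (f g : (nat * nat) * (nat * nat) -> nat)
    (k : (nat * nat) * (nat * nat) -> int) :
  \sum_(q <- quads n) k q =
    \sum_(q <- quads n | (f q < g q)%N) k q + \sum_(q <- quads n | (g q < f q)%N) k q
      + \sum_(q <- quads n | f q == g q) k q.
Proof.
rewrite (bigID (fun q => f q < g q)%N) /= -addrA; congr (_ + _).
rewrite (bigID (fun q => g q < f q)%N) /=.
by congr (_ + _); apply: eq_bigl => q; rewrite -?leqNgt; lia.
Qed.

Lemma quad_shift_lt n k :
  \sum_(q <- quads n | (q.2.1 < q.2.2)%N)
    k q.1.1 (q.1.1 + q.1.2)%N q.2.1 (q.2.2 - q.2.1)%N
  = \sum_(q <- quads n | (q.1.1 < q.1.2)%N) k q.1.1 q.1.2 q.2.1 q.2.2 :> int.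
Proof.
apply: (@reindex_seq _ _ _ _ _ _ _
  (fun q => ((q.1.1, (q.1.1 + q.1.2)%N), (q.2.1, (q.2.2 - q.2.1)%N)))
  (fun q => ((q.1.1, (q.1.2 - q.1.1)%N), (q.2.1, (q.2.2 + q.2.1)%N)))
  (fun q => k q.1.1 q.1.2 q.2.1 q.2.2)); rewrite ?uniq_quads //.
- move=> [[a b] [c d]]; rewrite !mem_quads /= => H lt_cd; split; [nia|lia|].
  by congr (_, _, (_, _)); lia.
- move=> [[a b] [c d]]; rewrite !mem_quads /= => H lt_cd; split; [nia|lia|].
  by congr (_, _, (_, _)); lia.
Qed.

Lemma quad_shift_gt n k :
  \sum_(q <- quads n | (q.2.2 < q.2.1)%N)
    k (q.1.1 + q.1.2)%N q.1.2 (q.2.1 - q.2.2)%N q.2.2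
  = \sum_(q <- quads n | (q.1.2 < q.1.1)%N) k q.1.1 q.1.2 q.2.1 q.2.2 :> int.
Proof.
apply: (@reindex_seq _ _ _ _ _ _ _
  (fun q => (((q.1.1 + q.1.2)%N, q.1.2), ((q.2.1 - q.2.2)%N, q.2.2)))
  (fun q => (((q.1.1 - q.1.2)%N, q.1.2), ((q.2.1 + q.2.2)%N, q.2.2)))
  (fun q => k q.1.1 q.1.2 q.2.1 q.2.2)); rewrite ?uniq_quads //.
- move=> [[a b] [c d]]; rewrite !mem_quads /= => H lt_cd; split; [nia|lia|].
  by congr (_, _, (_, _)); lia.
- move=> [[a b] [c d]]; rewrite !mem_quads /= => H lt_cd; split; [nia|lia|].
  by congr (_, _, (_, _)); lia.
Qed.

(** On the diagonal a = b the equation reads a (c + d) = n; N is c + d. *)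
Lemma quad_sum_diag_ab n k : (0 < n)%N ->
  \sum_(q <- quads n | q.1.1 == q.1.2) k q.1.1 q.1.2 q.2.1 q.2.2
  = \sum_(N <- divisors n) \sum_(1 <= c < N) k (n %/ N)%N (n %/ N)%N c (N - c)%N :> int.
Proof.
move=> n0; rewrite /index_iota -big_dpairs; apply/esym.
apply: (@reindex_seq _ _ _ _ _ _ _
  (fun p => (((n %/ p.1)%N, (n %/ p.1)%N), (p.2, (p.1 - p.2)%N)))
  (fun q => ((q.2.1 + q.2.2)%N, q.2.1))
  (fun q => k q.1.1 q.1.2 q.2.1 q.2.2)); rewrite ?uniq_quads //.
- by apply: uniq_dpairs => [|N]; rewrite ?divisors_uniq ?iota_uniq.
- move=> [N c]; rewrite mem_dpairs mem_iota mem_quads /= -dvdn_divisors //.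
  case/andP=> /dvdnP[a def_n] cN _; have N0 : (0 < N)%N by lia.
  rewrite def_n mulnK //; split=> //; first nia.
  by congr (_, _); lia.
- move=> [[a b] [c d]]; rewrite mem_dpairs mem_iota mem_quads /= => H /eqP eq_ab.
  have def_n : n = (a * (c + d))%N by nia.
  rewrite def_n mulnK ?eq_ab; last by lia.
  split=> //; last by congr (_, _, (_, _)); lia.
  by rewrite -dvdn_divisors ?dvdn_mull //; [lia | nia].
Qed.

(** On the diagonal c = d the equation reads c (a + b) = n; N is a + b. *)
Lemma quad_sum_diag_cd n k : (0 < n)%N ->
  \sum_(q <- quads n | q.2.1 == q.2.2) k q.1.1 q.1.2 q.2.1 q.2.2
  = \sum_(N <- divisors n) \sum_(1 <= a < N) k a (N - a)%N (n %/ N)%N (n %/ N)%N :> int.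
Proof.
move=> n0; rewrite /index_iota -big_dpairs; apply/esym.
apply: (@reindex_seq _ _ _ _ _ _ _
  (fun p => ((p.2, (p.1 - p.2)%N), ((n %/ p.1)%N, (n %/ p.1)%N)))
  (fun q => ((q.1.1 + q.1.2)%N, q.1.1))
  (fun q => k q.1.1 q.1.2 q.2.1 q.2.2)); rewrite ?uniq_quads //.
- by apply: uniq_dpairs => [|N]; rewrite ?divisors_uniq ?iota_uniq.
- move=> [N a]; rewrite mem_dpairs mem_iota mem_quads /= -dvdn_divisors //.
  case/andP=> /dvdnP[c def_n] aN _; have N0 : (0 < N)%N by lia.
  rewrite def_n mulnK //; split=> //; first nia.
  by congr (_, _); lia.
- move=> [[a b] [c d]]; rewrite mem_dpairs mem_iota mem_quads /= => H /eqP eq_cd.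
  have def_n : n = (c * (a + b))%N by nia.
  rewrite def_n mulnK ?eq_cd; last by lia.
  split=> //; last by congr (_, _, (_, _)); lia.
  by rewrite -dvdn_divisors ?dvdn_mull //; [lia | nia].
Qed.

(** The maps (a, b, c, d) -> (a, a + b, c, d - c) for c < d and
    (a, b, c, d) -> (a + b, b, c - d, d) for d < c together form a bijection
    from the quadruples with c <> d onto those with a <> b (quad_shift_lt and
    quad_shift_gt). So the sum of k minus its shift collapses to the sum of k
    over a = b minus its sum over c = d. *)
Lemma quad_sum_telescope n (k : nat -> nat -> nat -> nat -> int)
    (P : nat -> nat -> int) :
    (0 < n)%N ->
    (forall a b c d, [&& 0 < a, 0 < b, 0 < c & c < d]%N ->
       k a b c d - k a (a + b)%N c (d - c)%N = P a b) ->
    (forall a b c d, [&& 0 < a, 0 < b, 0 < d & d < c]%N ->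
       k a b c d - k (a + b)%N b (c - d)%N d = P a b) ->
  \sum_(q <- quads n) P q.1.1 q.1.2 =
    \sum_(N <- divisors n) \sum_(1 <= a < N)
       (P a (N - a)%N - k a (N - a)%N (n %/ N)%N (n %/ N)%N)
    + \sum_(N <- divisors n) \sum_(1 <= c < N)
       k (n %/ N)%N (n %/ N)%N c (N - c)%N.
Proof.
move=> n0 k_lt k_gt.
rewrite -(quad_sum_diag_cd (fun a b c d => P a b - k a b c d)) //.
rewrite -quad_sum_diag_ab //.
rewrite (@quads_split n (fun q => q.2.1) (fun q => q.2.2)).
pose K (q : (nat * nat) * (nat * nat)) := k q.1.1 q.1.2 q.2.1 q.2.2.
have sum_lt : \sum_(q <- quads n | (q.2.1 < q.2.2)%N) P q.1.1 q.1.2 =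
    \sum_(q <- quads n | (q.2.1 < q.2.2)%N) K q
    - \sum_(q <- quads n | (q.1.1 < q.1.2)%N) K q.
  rewrite -(quad_shift_lt n k) -sumrB [LHS]big_seq_cond [RHS]big_seq_cond.
  apply: eq_bigr => [[[a b] [c d]]]; rewrite mem_quads /= => H.
  by rewrite -(k_lt a b c d) //; lia.
have sum_gt : \sum_(q <- quads n | (q.2.2 < q.2.1)%N) P q.1.1 q.1.2 =
    \sum_(q <- quads n | (q.2.2 < q.2.1)%N) K q
    - \sum_(q <- quads n | (q.1.2 < q.1.1)%N) K q.
  rewrite -(quad_shift_gt n k) -sumrB [LHS]big_seq_cond [RHS]big_seq_cond.
  apply: eq_bigr => [[[a b] [c d]]]; rewrite mem_quads /= => H.
  by rewrite -(k_gt a b c d) //; lia.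
have := @quads_split n (fun q => q.1.1) (fun q => q.1.2) K.
rewrite (@quads_split n (fun q => q.2.1) (fun q => q.2.2) K) /K => eqK.
rewrite sum_lt sum_gt sumrB.
have rearrange (x1 x2 x3 y1 y2 y3 p : int) : x1 + x2 + x3 = y1 + y2 + y3 ->
  x1 - y1 + (x2 - y2) + p = p - x3 + y3 by lia.
exact: rearrange eqK.
Qed.

Definition sigma (k n : nat) : int := \sum_(d <- divisors n) d%:Z ^+ k.

(** The terms a d and b c of the equation split n as m + (n - m), with a
    running over the divisors of m and b over those of n - m. *)
Lemma sigma_convolution n i j :
  \sum_(q <- quads n) q.1.1%:Z ^+ i * q.1.2%:Z ^+ j =
  \sum_(1 <= m < n) sigma i m * sigma j (n - m).
Proof.
transitivity (\sum_(p <- dpairs (dpairs (iota 1 (n - 1)) divisors)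
                                (fun p => divisors (n - p.1)))
                p.1.2%:Z ^+ i * p.2%:Z ^+ j); last first.
  rewrite (big_dpairs _ _ (fun p b => p.2%:Z ^+ i * b%:Z ^+ j)).
  rewrite (big_dpairs _ _ (fun m a => \sum_(b <- divisors (n - m)) a%:Z ^+ i * b%:Z ^+ j)).
  apply: eq_bigr => m _; rewrite /sigma big_distrl; apply: eq_bigr => a _.
  by rewrite big_distrr.
apply/esym.
apply: (@reindex_seq _ _ _ _ _ _ _
  (fun p => ((p.1.2, p.2), (((n - p.1.1) %/ p.2)%N, (p.1.1 %/ p.1.2)%N)))
  (fun q => (((q.1.1 * q.2.2)%N, q.1.1), q.1.2))
  (fun q => q.1.1%:Z ^+ i * q.1.2%:Z ^+ j)); rewrite ?uniq_quads //.
- apply: uniq_dpairs => [|[? ?]]; rewrite ?divisors_uniq //.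
  by apply: uniq_dpairs => [|?]; rewrite ?divisors_uniq ?iota_uniq.
- move=> [[m a] b]; rewrite !mem_dpairs mem_iota mem_quads /=.
  case/andP=> /andP[m_n]; rewrite -!dvdn_divisors; [|lia|lia].
  case/dvdnP=> d def_m /dvdnP[c def_nm] _.
  have [a0 b0] : (0 < a)%N /\ (0 < b)%N by nia.
  rewrite def_nm def_m !mulnK //; split=> //; first nia.
  by congr (_, _, _); lia.
- move=> [[a b] [c d]]; rewrite !mem_dpairs mem_iota mem_quads /= => H _.
  have -> : (n - a * d = c * b)%N by nia.
  rewrite !mulnK ?mulKn; [|lia..].
  have [ad0 bc0 lt_ad] : [/\ 0 < a * d, 0 < c * b & a * d < n]%N by split; nia.
  split=> //; rewrite -!dvdn_divisors // dvdn_mulr // dvdn_mull //.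
  by rewrite ad0; lia.
Qed.

Lemma sigma_convolutionC n i j :
  \sum_(1 <= m < n) sigma i m * sigma j (n - m) =
  \sum_(1 <= m < n) sigma j m * sigma i (n - m).
Proof.
rewrite big_nat_rev /=; apply: eq_big_nat => m lt_mn.
by rewrite mulrC; congr (sigma _ _ * sigma _ _); lia.
Qed.

Lemma sum_antidifference (g G : int -> int) (N : nat) :
    G 1 = 0 -> (forall x, G (x + 1) = G x + g x) -> (0 < N)%N ->
  \sum_(1 <= a < N) g a%:Z = G N%:Z.
Proof.
move=> G1 GS; case: N => // N _; elim: N => [|N IHN]; first by rewrite big_nil G1.
by rewrite big_nat_recr //= IHN -GS -[N.+2]addn1 PoszD.
Qed.

Lemma sum_divisors_swap (R : nmodType) n (f : nat -> R) : (0 < n)%N ->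
  \sum_(d <- divisors n) f (n %/ d)%N = \sum_(d <- divisors n) f d.
Proof.
move=> n0; apply: (@reindex_seq _ _ _ _ _ _ _ (fun d => n %/ d)%N (fun d => n %/ d)%N);
  rewrite ?divisors_uniq // => d; rewrite -!dvdn_divisors // => dn _;
  by rewrite dvdn_div ?divnA ?mulKn ?n0.
Qed.

Lemma sum_sigma n k : \sum_(d <- divisors n) d%:Z ^+ k = sigma k n.
Proof. by []. Qed.

Lemma sum_codivisors_pred n D : (0 < n)%N ->
  \sum_(N <- divisors n) (N%:Z - 1) * (n %/ N)%:Z ^+ D.+1
    = n%:Z * sigma D n - sigma D.+1 n.
Proof.
move=> n0; transitivity (\sum_(N <- divisors n) (n%:Z * (n %/ N)%:Z ^+ D - (n %/ N)%:Z ^+ D.+1)).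
  apply: eq_big_seq => N; rewrite -dvdn_divisors // => /dvdnP[a ->].
  case: N => [|N]; first by rewrite muln0 div0n !expr0n /= !mul0r !mulr0 ?subr0; case: D.
  by rewrite mulnK // PoszM exprS; ring.
rewrite sumrB -mulr_sumr (sum_divisors_swap (fun d => d%:Z ^+ D)) //.
by rewrite (sum_divisors_swap (fun d => d%:Z ^+ D.+1)).
Qed.

(** Telescoping with k = h (a, b), for which the two possible shifts must have
    the same effect P. On c = d the two summands combine to - h (a, a + b); on
    a = b homogeneity leaves h 1 1 times a power of a. *)
Lemma quad_sum_poly n D (h P : int -> int -> int) :
    (0 < n)%N ->
    (forall x y, h x y - h x (x + y) = P x y) ->
    (forall x y, h x y - h (x + y) y = P x y) ->
    (forall t, h t t = h 1 1 * t ^+ D.+1) ->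
  \sum_(q <- quads n) P q.1.1%:Z q.1.2%:Z =
    - \sum_(N <- divisors n) \sum_(1 <= a < N) h a%:Z N%:Z
    + h 1 1 * (n%:Z * sigma D n - sigma D.+1 n).
Proof.
move=> n0 hy hx hD.
rewrite (@quad_sum_telescope n (fun a b _ _ => h a%:Z b%:Z) (fun a b => P a%:Z b%:Z)) //.
congr (_ + _).
  rewrite -sumrN; apply: eq_bigr => N _; rewrite -sumrN; apply: eq_big_nat => a aN.
  by rewrite -hy -PoszD subnKC; [ring | lia].
rewrite -sum_codivisors_pred // mulr_sumr; apply: eq_big_seq => N.
rewrite -dvdn_divisors // => Nn; have N0 := dvdn_gt0 n0 Nn.
rewrite hD big_const_nat iter_addr addr0 -mulr_natr.
have -> : (N - 1)%:R = N%:Z - 1 :> int by rewrite natrB // natz.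
by ring.
Qed.

(** The inner sum of h in closed form: G is a discrete antiderivative of M h in
    its first variable, M clearing the denominators of the Bernoulli numbers. *)
Lemma quad_sum_faulhaber n D M (h P G : int -> int -> int) :
    (0 < n)%N ->
    (forall x y, h x y - h x (x + y) = P x y) ->
    (forall x y, h x y - h (x + y) y = P x y) ->
    (forall t, h t t = h 1 1 * t ^+ D.+1) ->
    (forall y, G 1 y = 0) -> (forall x y, G (x + 1) y = G x y + M * h x y) ->
  M * \sum_(q <- quads n) P q.1.1%:Z q.1.2%:Z =
    - \sum_(N <- divisors n) G N%:Z N%:Z
    + M * h 1 1 * (n%:Z * sigma D n - sigma D.+1 n).
Proof.
move=> n0 hy hx hD G1 GS; rewrite (quad_sum_poly n0 hy hx hD) mulrDr mulrN mulrA.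
congr (- _ + _); rewrite mulr_sumr; apply: eq_big_seq => N.
rewrite -dvdn_divisors // => Nn; have N0 := dvdn_gt0 n0 Nn.
rewrite mulr_sumr (@sum_antidifference (fun x => M * h x N%:Z) (fun x => G x N%:Z)) //.
Qed.

(** This is the coefficientwise form of E4^2 = E8. The polynomial h solves the
    linear system expressed by the two shift equations, with P = 4 x^3 y^3. *)
Lemma sigma3_sigma3 n : (0 < n)%N ->
  120 * \sum_(1 <= m < n) sigma 3 m * sigma 3 (n - m) = sigma 7 n - sigma 3 n.
Proof.
move=> n0; rewrite -sigma_convolution.
have := @quad_sum_faulhaber n 5 30
  (fun x y => - x ^+ 2 * y ^+ 4 + 2 * x ^+ 3 * y ^+ 3 - x ^+ 4 * y ^+ 2)
  (fun x y => 4 * (x ^+ 3 * y ^+ 3))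
  (fun N y => N * y ^+ 2 - 5 * N * y ^+ 4 + 15 * N ^+ 2 * y ^+ 3
  + 15 * N ^+ 2 * y ^+ 4 - 10 * N ^+ 3 * y ^+ 2 - 30 * N ^+ 3 * y ^+ 3
  - 10 * N ^+ 3 * y ^+ 4 + 15 * N ^+ 4 * y ^+ 2 + 15 * N ^+ 4 * y ^+ 3
  - 6 * N ^+ 5 * y ^+ 2) n0.
rewrite -!mulr_sumr mulrA => -> *; try ring.
rewrite (eq_bigr (fun N => - (N%:Z ^+ 7 - N%:Z ^+ 3))) => [|N _]; last by ring.
by rewrite sumrN sumrB !sum_sigma; ring.
Qed.

(** The differential equation of E4. The terms n sigma come from the diagonal
    a = b. *)
Lemma sigma1_sigma3 n : (0 < n)%N ->
  240 * \sum_(1 <= m < n) sigma 1 m * sigma 3 (n - m)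
  = 21 * sigma 5 n - 30 * n%:Z * sigma 3 n + 10 * sigma 3 n - sigma 1 n.
Proof.
move=> n0; rewrite -sigma_convolution.
have := @quad_sum_faulhaber n 3 30
  (fun x y => - y ^+ 4 + 2 * x * y ^+ 3 - 3 * x ^+ 2 * y ^+ 2
              + 2 * x ^+ 3 * y - x ^+ 4)
  (fun x y => 4 * (x ^+ 1 * y ^+ 3) + 4 * (x ^+ 3 * y ^+ 1))
  (fun N y => 30 * y ^+ 4 + N - 15 * N * y ^+ 2 - 30 * N * y ^+ 3
  - 30 * N * y ^+ 4 + 15 * N ^+ 2 * y + 45 * N ^+ 2 * y ^+ 2
  + 30 * N ^+ 2 * y ^+ 3 - 10 * N ^+ 3 - 30 * N ^+ 3 * y - 30 * N ^+ 3 * y ^+ 2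
  + 15 * N ^+ 4 + 15 * N ^+ 4 * y - 6 * N ^+ 5) n0.
rewrite big_split -!mulr_sumr /= !sigma_convolution (sigma_convolutionC n 3 1).
set S := \sum_(1 <= m < n) _ => eqS.
rewrite (_ : 240 * S = 30 * (4 * S + 4 * S)); last by ring.
rewrite eqS => *; try ring.
rewrite (eq_bigr (fun N => - (21 * N%:Z ^+ 5 - 30 * N%:Z ^+ 4
  + 10 * N%:Z ^+ 3 - N%:Z ^+ 1))) => [|N _]; last by ring.
by rewrite sumrN !(sumrB, big_split) -?mulr_sumr /= ?sum_sigma; ring.
Qed.

(** The differential equation of E6, by the same method. *)
Lemma sigma1_sigma5 n : (0 < n)%N ->
  504 * \sum_(1 <= m < n) sigma 1 m * sigma 5 (n - m)
  = 20 * sigma 7 n - 42 * n%:Z * sigma 5 n + 21 * sigma 5 n + sigma 1 n.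
Proof.
move=> n0; rewrite -sigma_convolution.
have := @quad_sum_faulhaber n 5 42
  (fun x y => - 2 * y ^+ 6 + 6 * x * y ^+ 5 - 5 * x ^+ 2 * y ^+ 4
              - 5 * x ^+ 4 * y ^+ 2 + 6 * x ^+ 5 * y - 2 * x ^+ 6)
  (fun x y => 12 * (x ^+ 1 * y ^+ 5) + 12 * (x ^+ 5 * y ^+ 1))
  (fun N y => 84 * y ^+ 6 - 2 * N + 7 * N * y ^+ 2 - 35 * N * y ^+ 4
  - 126 * N * y ^+ 5 - 84 * N * y ^+ 6 - 21 * N ^+ 2 * y
  + 105 * N ^+ 2 * y ^+ 4 + 126 * N ^+ 2 * y ^+ 5 + 14 * N ^+ 3
  - 70 * N ^+ 3 * y ^+ 2 - 70 * N ^+ 3 * y ^+ 4 + 105 * N ^+ 4 * y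
  + 105 * N ^+ 4 * y ^+ 2 - 42 * N ^+ 5 - 126 * N ^+ 5 * y
  - 42 * N ^+ 5 * y ^+ 2 + 42 * N ^+ 6 + 42 * N ^+ 6 * y - 12 * N ^+ 7) n0.
rewrite big_split -!mulr_sumr /= !sigma_convolution (sigma_convolutionC n 5 1).
set S := \sum_(1 <= m < n) _ => eqS.
apply: (@mulfI _ 2) => //; rewrite (_ : 2 * (504 * S) = 42 * (12 * S + 12 * S)); last by ring.
rewrite eqS => *; try ring.
rewrite (eq_bigr (fun N => - (40 * N%:Z ^+ 7 - 84 * N%:Z ^+ 6
  + 42 * N%:Z ^+ 5 + 2 * N%:Z ^+ 1))) => [|N _]; last by ring.
by rewrite sumrN !(sumrB, big_split) -?mulr_sumr /= ?sum_sigma; ring.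
Qed.

(** * Eisenstein series and the product for Delta, modulo a power of X *)

(** Power series are represented by polynomials modulo X^N. The explicit
    quotient r makes consequences of several congruences provable by ring. *)
Definition congX (N : nat) (p q : {poly int}) : Prop := exists r, p = q + 'X^N * r.

Lemma congXP N p q : congX N p q <-> forall i, (i < N)%N -> p`_i = q`_i.
Proof.
split=> [[r ->] i ltiN|eq_pq]; first by rewrite coefD coefXnM ltiN addr0.
exists (drop_poly N (p - q)).
suff t0 : take_poly N (p - q) = 0.
  by rewrite mulrC -[_ * _]add0r -t0 poly_take_drop addrC subrK.
apply/polyP=> i; rewrite coef_take_poly coef0; case: ifP => // ltiN.
by rewrite coefB eq_pq // subrr.
Qed.

(** The Euler operator q d/dq. *)
Definition theta_op (p : {poly int}) : {poly int} := 'X * p^`().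

Lemma coef_theta p i : (theta_op p)`_i = i%:Z * p`_i.
Proof.
rewrite coefXM coef_deriv; case: i => [|i] /=; first by rewrite mul0r.
by rewrite -mulr_natl natz.
Qed.

(** The constant term is set to 0 because the list of divisors of 0 is not
    empty. *)
Definition sigma_poly (N k : nat) : {poly int} :=
  \poly_(i < N) (if i is 0 then 0 else sigma k i).

Lemma coef_sigma_poly N k i : (i < N)%N ->
  (sigma_poly N k)`_i = if i is 0 then 0 else sigma k i.
Proof. by move=> ltiN; rewrite coef_poly ltiN. Qed.

Lemma coef_sigma_polyM N j k n : (n < N)%N ->
  (sigma_poly N j * sigma_poly N k)`_n = \sum_(1 <= m < n) sigma j m * sigma k (n - m).
Proof.
move=> ltnN; rewrite coefM -(big_mkord xpredT (fun m =>
  (sigma_poly N j)`_m * (sigma_poly N k)`_(n - m))) big_nat_recr //= subnn.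
rewrite [(sigma_poly N k)`_0]coef_sigma_poly; last by lia.
rewrite mulr0 addr0; case: n ltnN => [|n] ltnN; first by rewrite !big_geq.
rewrite big_ltn // coef_sigma_poly; last by lia.
rewrite mul0r add0r; apply: eq_big_nat => m lt_mn; rewrite !coef_sigma_poly; [|lia..].
case: m lt_mn => // m lt_mn; have -> : (n.+1 - m.+1 = (n - m.+1).+1)%N by lia.
by [].
Qed.

Definition eisE2 N : {poly int} := 1 - 24 * sigma_poly N 1.
Definition eisE4 N : {poly int} := 1 + 240 * sigma_poly N 3.
Definition eisE6 N : {poly int} := 1 - 504 * sigma_poly N 5.
Definition eisE8 N : {poly int} := 1 + 480 * sigma_poly N 7.

Lemma thetaD p q : theta_op (p + q) = theta_op p + theta_op q.
Proof. by rewrite /theta_op derivD mulrDr. Qed.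

Lemma thetaM p q : theta_op (p * q) = theta_op p * q + p * theta_op q.
Proof. by rewrite /theta_op derivM; ring. Qed.

Lemma thetaN p : theta_op (- p) = - theta_op p.
Proof. by rewrite /theta_op derivN mulrN. Qed.

Lemma coef_natM (m : nat) (p : {poly int}) i : (m%:R * p)`_i = m%:R * p`_i.
Proof. by rewrite mulr_natl coefMn mulr_natl. Qed.

Lemma theta_natM (m : nat) p : theta_op (m%:R * p) = m%:R * theta_op p.
Proof. by rewrite /theta_op mulr_natl derivMn mulrnAr mulr_natl. Qed.

Lemma theta1 : theta_op 1 = 0.
Proof. by rewrite /theta_op derivC mulr0. Qed.

Lemma eisE8E N : congX N (eisE4 N ^+ 2) (eisE8 N).
Proof.
have /congXP[r eq_r] i : (i < N)%N ->
    (120 * (sigma_poly N 3 * sigma_poly N 3))`_i = (sigma_poly N 7 - sigma_poly N 3)`_i.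
  move=> ltiN; rewrite coef_natM coef_sigma_polyM // coefB !coef_sigma_poly //.
  by case: i ltiN => [|i] _; [rewrite big_geq // | rewrite sigma3_sigma3].
exists (480 * r); rewrite /eisE4 /eisE8; set S3 := sigma_poly N 3 in eq_r *.
rewrite [LHS](_ : _ = 1 + 480 * S3 + 480 * (120 * (S3 * S3))); last by ring.
by rewrite eq_r; ring.
Qed.

Lemma theta_eisE4 N : congX N (3 * theta_op (eisE4 N)) (eisE2 N * eisE4 N - eisE6 N).
Proof.
have /congXP[r eq_r] i : (i < N)%N ->
    (240 * (sigma_poly N 1 * sigma_poly N 3))`_i =
    (21 * sigma_poly N 5 - 30 * theta_op (sigma_poly N 3)
       + 10 * sigma_poly N 3 - sigma_poly N 1)`_i.
  move=> ltiN; rewrite !(coefB, coefD, coef_natM) coef_theta coef_sigma_polyM //.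
  rewrite !coef_sigma_poly //.
  by case: i ltiN => [|i] _; [rewrite big_geq //; ring | rewrite sigma1_sigma3 //; ring].
exists (24 * r); rewrite /eisE2 /eisE4 /eisE6 thetaD theta1 theta_natM.
set S1 := sigma_poly N 1 in eq_r *; set S3 := sigma_poly N 3 in eq_r *.
rewrite [(1 - 24 * S1) * _](_ : _ = 1 + 240 * S3 - 24 * S1 - 24 * (240 * (S1 * S3)));
  last by ring.
by rewrite eq_r; ring.
Qed.

Lemma theta_eisE6 N : congX N (2 * theta_op (eisE6 N)) (eisE2 N * eisE6 N - eisE8 N).
Proof.
have /congXP[r eq_r] i : (i < N)%N ->
    (504 * (sigma_poly N 1 * sigma_poly N 5))`_i =
    (20 * sigma_poly N 7 - 42 * theta_op (sigma_poly N 5)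
       + 21 * sigma_poly N 5 + sigma_poly N 1)`_i.
  move=> ltiN; rewrite !(coefB, coefD, coef_natM) coef_theta coef_sigma_polyM //.
  rewrite !coef_sigma_poly //.
  by case: i ltiN => [|i] _; [rewrite big_geq //; ring | rewrite sigma1_sigma5 //; ring].
exists (- 24 * r); rewrite /eisE2 /eisE8 /eisE6 thetaD theta1 thetaN theta_natM.
set S1 := sigma_poly N 1 in eq_r *; set S5 := sigma_poly N 5 in eq_r *.
rewrite [(1 - 24 * S1) * _](_ : _ = 1 - 504 * S5 - 24 * S1 + 24 * (504 * (S1 * S5)));
  last by ring.
by rewrite eq_r; ring.
Qed.

(** The Lambert series k X^k / (1 - X^k), truncated. It is minus the
    logarithmic derivative of 1 - X^k for the Euler operator. *)
Definition lambert_poly (N k : nat) : {poly int} :=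
  \poly_(i < N) (if (0 < i)%N && (k %| i)%N then k%:Z else 0).

Lemma coef_lambert_poly N k i : (i < N)%N ->
  (lambert_poly N k)`_i = if (0 < i)%N && (k %| i)%N then k%:Z else 0.
Proof. by move=> ltiN; rewrite coef_poly ltiN. Qed.

Lemma theta_1subXn k : theta_op (1 - 'X^k) = - (k%:Z%:P * 'X^k).
Proof.
apply/polyP=> i; rewrite coef_theta coefB coefN coef1 coefCM coefXn.
have [->|_] := eqVneq i k; have [->|k0] := eqVneq _ 0%N; rewrite ?eqxx ?(negPf k0) /=; ring.
Qed.

Lemma lambert_polyM N k : (0 < k)%N ->
  congX N ((1 - 'X^k) * lambert_poly N k) (k%:Z%:P * 'X^k).
Proof.
move=> k0; apply/congXP=> i ltiN; rewrite mulrBl mul1r coefB coefXnM coefCM coefXn.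
rewrite coef_lambert_poly //; case: (ltnP i k) => [lt_ik | le_ki].
  case: (posnP i) => [->|i0]; first by rewrite ltn_eqF // mulr0.
  by rewrite ltn_eqF // gtnNdvd // andbF mulr0 subr0.
rewrite coef_lambert_poly; last by lia.
rewrite -(subnKC le_ki) addKn dvdn_addr // addn_gt0 k0 /=.
case: (i - k)%N => [|j]; first by rewrite dvdn0 addn0 eqxx subr0 mulr1.
by rewrite subrr gtn_eqF ?mulr0 //; lia.
Qed.

Lemma sum_lambert_poly N :
  congX N.+1 (\sum_(1 <= k < N.+1) lambert_poly N.+1 k) (sigma_poly N.+1 1).
Proof.
apply/congXP=> i ltiN; rewrite coef_sum coef_sigma_poly //.
under eq_bigr => k _ do rewrite coef_lambert_poly //.
case: i ltiN => [|i] ltiN /=; first by rewrite big1.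
rewrite -big_mkcond /= /index_iota subn1 /= /sigma.
apply: (@reindex_seq _ _ _ _ _ (fun k => k %| i.+1)%N predT id id (fun k => k%:Z ^+ 1));
  rewrite ?iota_uniq ?divisors_uniq //.
- by move=> k; rewrite -dvdn_divisors.
- move=> k; rewrite -dvdn_divisors // mem_iota => k_dvd _; split=> //.
  by have := dvdn_leq _ k_dvd; have := dvdn_gt0 _ k_dvd; lia.
Qed.

Lemma thetaX p n : theta_op (p ^+ n.+1) = n.+1%:R * p ^+ n * theta_op p.
Proof.
by rewrite /theta_op deriv_exp -mulr_natl /=; ring.
Qed.

Lemma theta_euler_prod N M : (M <= N)%N ->
  congX N.+1 (theta_op (\prod_(1 <= k < M.+1) (1 - 'X^k) ^+ 24))
    (- 24 * (\sum_(1 <= k < M.+1) lambert_poly N.+1 k)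
       * \prod_(1 <= k < M.+1) (1 - 'X^k) ^+ 24).
Proof.
elim: M => [|M IHM] ltMN; first by rewrite !big_geq // theta1; exists 0; ring.
have [r eq_r] := IHM (ltnW ltMN).
have [s eq_s] := @lambert_polyM N.+1 M.+1 isT.
rewrite !(big_nat_recr M.+1) //= thetaM eq_r thetaX theta_1subXn.
set F : {poly int} := \prod_(1 <= _ < _) _; set L : {poly int} := \sum_(1 <= _ < _) _.
set l := lambert_poly _ _ in eq_s *; set u : {poly int} := 1 - 'X^_ in eq_s *.
(* theta u = - k X^k is congruent to - u l, so theta (u^24) is congruent to - 24 u^24 l. *)
exists (u ^+ 24 * r + 24 * F * u ^+ 23 * s).
have -> : - (M.+1%:Z%:P * 'X^(M.+1)) = 'X^(N.+1) * s - u * l :> {poly int} by rewrite eq_s; ring.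
by ring.
Qed.

(** The logarithmic derivative of the product is
    1 - 24 times a sum of Lambert series, and that sum is the generating
    function of sigma 1. *)
Lemma theta_tau_prod N :
  congX N.+1 (theta_op (tau_prod N)) (eisE2 N.+1 * tau_prod N).
Proof.
rewrite /tau_prod /eisE2.
have [r eq_r] := theta_euler_prod (leqnn N).
have [s eq_s] := sum_lambert_poly N.
rewrite thetaM eq_r; set F : {poly int} := \prod_(1 <= _ < _) _.
have -> : theta_op 'X = 'X by rewrite /theta_op derivX mulr1.
set L : {poly int} := \sum_(1 <= _ < _) _ in eq_s *.
exists ('X * r - 24 * s * 'X * F).
have -> : sigma_poly N.+1 1 = L - 'X^(N.+1) * s by rewrite eq_s addrK.
by ring.
Qed.

(** At X^i the equation reads i p_i = p_i + (terms with smaller index), which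
    determines p_i as soon as i > 1. *)
Lemma theta_ode_unique N (p q : {poly int}) :
    congX N (theta_op p) (eisE2 N * p) -> congX N (theta_op q) (eisE2 N * q) ->
    p`_0 = q`_0 -> p`_1 = q`_1 ->
  forall i, (i < N)%N -> p`_i = q`_i.
Proof.
move=> /congXP odep /congXP odeq eq0 eq1; elim/ltn_ind=> [[|[|i]]] // IH ltiN.
have := odep _ ltiN; have := odeq _ ltiN.
rewrite !coef_theta !coefM !(big_ord_recl i.+2) /= subn0.
have -> : (eisE2 N)`_0 = 1.
  by rewrite coefB coef1 coef_natM coef_sigma_poly ?mulr0 ?subr0 //; lia.
have -> : \sum_(j < i.+2) (eisE2 N)`_(bump 0 j) * q`_(i.+2 - bump 0 j)
        = \sum_(j < i.+2) (eisE2 N)`_(bump 0 j) * p`_(i.+2 - bump 0 j).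
  by apply: eq_bigr => j _; rewrite IH //= /bump /=; lia.
set S := \sum_(j < _) _ => eq_q eq_p.
apply: (@mulfI _ i.+1%:Z) => //; lia.
Qed.

(** G = E4^3 - E6^2 satisfies the same differential equation as Delta, by
    Ramanujan's equations:
      3 E4^2 theta E4 - 2 E6 theta E6
        = E4^2 (E2 E4 - E6) - E6 (E2 E6 - E4^2) = E2 G.
    So G = 1728 Delta, and replacing E4^2 by E8 in G leaves only products of
    two Eisenstein series. *)
Lemma tau_eisenstein n : (0 < n)%N ->
  1728 * tau n = 480 * sigma 7 n + 240 * sigma 3 n + 1008 * sigma 5 n
    + 480 * 240 * (\sum_(1 <= m < n) sigma 3 m * sigma 7 (n - m))
    - 504 * 504 * (\sum_(1 <= m < n) sigma 5 m * sigma 5 (n - m)).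
Proof.
move=> n0; rewrite -(@tau_prodE n n) //.
pose G : {poly int} := eisE4 n.+1 ^+ 3 - eisE6 n.+1 ^+ 2.
have congG : congX n.+1 G (eisE4 n.+1 * eisE8 n.+1 - eisE6 n.+1 ^+ 2).
  have [r eq_r] := eisE8E n.+1; exists (eisE4 n.+1 * r).
  by rewrite /G exprS eq_r; ring.
have coefG i : (i < n.+1)%N -> G`_i = if i is 0 then 0 else
    480 * sigma 7 i + 240 * sigma 3 i + 1008 * sigma 5 i
    + 480 * 240 * (\sum_(1 <= m < i) sigma 3 m * sigma 7 (i - m))
    - 504 * 504 * (\sum_(1 <= m < i) sigma 5 m * sigma 5 (i - m)).
  move=> ltin; have /congXP-> // := congG.
  have -> : eisE4 n.+1 * eisE8 n.+1 - eisE6 n.+1 ^+ 2 =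
      480 * sigma_poly n.+1 7 + 240 * sigma_poly n.+1 3 + 1008 * sigma_poly n.+1 5
      + 480 * (240 * (sigma_poly n.+1 3 * sigma_poly n.+1 7))
      - 504 * (504 * (sigma_poly n.+1 5 * sigma_poly n.+1 5)).
    by rewrite /eisE4 /eisE6 /eisE8; ring.
  rewrite !(coefB, coefD, coef_natM) !coef_sigma_polyM // !coef_sigma_poly //.
  by case: i ltin => [|i] _; rewrite ?(big_geq (leq0n _)) //; ring.
have odeG : congX n.+1 (theta_op G) (eisE2 n.+1 * G).
  have [r eq_r] := theta_eisE4 n.+1; have [s eq_s] := theta_eisE6 n.+1.
  have [t eq_t] := eisE8E n.+1.
  exists (eisE4 n.+1 ^+ 2 * r - eisE6 n.+1 * s - eisE6 n.+1 * t).
  rewrite /G thetaD thetaN !thetaX.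
  rewrite (_ : _ - _ = eisE4 n.+1 ^+ 2 * (3 * theta_op (eisE4 n.+1))
                     - eisE6 n.+1 * (2 * theta_op (eisE6 n.+1))); last by ring.
  rewrite eq_r eq_s (_ : eisE8 n.+1 = eisE4 n.+1 ^+ 2 - 'X^(n.+1) * t);
    last by rewrite eq_t addrK.
  by ring.
have odeD : congX n.+1 (theta_op (1728 * tau_prod n)) (eisE2 n.+1 * (1728 * tau_prod n)).
  have [r eq_r] := theta_tau_prod n; exists (1728 * r).
  by rewrite theta_natM eq_r; ring.
have D0 : (1728 * tau_prod n)`_0 = 0 by rewrite coef_natM coefXM mulr0.
have D1 : (1728 * tau_prod n)`_1 = 1728.
  rewrite coef_natM coefXM /= -horner_coef0 horner_prod big_nat big1 ?mulr1 //.
  move=> [//|k] _; rewrite horner_exp hornerD hornerN hornerXn hornerC expr0n /=.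
  by rewrite subr0 expr1n.
have sigma1 k : sigma k 1 = 1 by rewrite /sigma big_seq1 expr1n.
have : (1728 * tau_prod n)`_n = G`_n.
  apply: (theta_ode_unique odeD odeG) => //; first by rewrite D0 coefG.
  by rewrite D1 coefG ?ltnS // !big_geq // !sigma1 !mulr0 subr0 addr0.
by rewrite coef_natM coefG //; case: n n0 {G congG coefG odeG odeD D0 D1}.
Qed.

(** * Even period polynomials and their Eichler cocycles *)

(** Binary forms as functions on Z^2. Generating them by products of linear
    forms makes stability under linear substitutions (homog_comp) an immediate
    induction. *)
Inductive homog : nat -> (int -> int -> int) -> Prop :=
| homog_const c : homog 0 (fun _ _ => c)
| homog_lin d F a b : homog d F -> homog d.+1 (fun x y => (a * x + b * y) * F x y)
| homog_add d F G : homog d F -> homog d G -> homog d (fun x y => F x y + G x y)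
| homog_ext d F G : (forall x y, F x y = G x y) -> homog d F -> homog d G.

Lemma homog_comp d F a b a' b' :
  homog d F -> homog d (fun x y => F (a * x + b * y) (a' * x + b' * y)).
Proof.
elim=> {d F} [c|d F e f _ IH|d F G _ IHF _ IHG|d F G eqFG _ IH].
- exact: homog_const.
- apply: homog_ext (homog_lin (e * a + f * a') (e * b + f * b') IH) => x y.
  by ring.
- exact: homog_add IHF IHG.
- by apply: homog_ext IH => x y; apply: eqFG.
Qed.

Lemma homog_scale d F t x y : homog d F -> F (t * x) (t * y) = t ^+ d * F x y.
Proof.
elim=> {d F} [c|d F e f _ IH|d F G _ IHF _ IHG|d F G eqFG _ IH].
- by rewrite mul1r.
- by rewrite IH exprS; ring.
- by rewrite IHF IHG; ring.
- by rewrite -!eqFG.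
Qed.

Lemma homog_mulc d F c : homog d F -> homog d (fun x y => c * F x y).
Proof.
elim=> {d F} [c'|d F e f _ IH|d F G _ IHF _ IHG|d F G eqFG _ IH].
- exact: homog_const.
- by apply: homog_ext (homog_lin e f IH) => x y; ring.
- by apply: homog_ext (homog_add IHF IHG) => x y; ring.
- by apply: homog_ext IH => x y; rewrite eqFG.
Qed.

Lemma homog_coef d F : homog d F ->
  exists c : nat -> int, forall x y, F x y = \sum_(i < d.+1) c i * x ^+ i * y ^+ (d - i).
Proof.
elim=> {d F} [c|d F e f _ [c IH]|d F G _ [c IHF] _ [c' IHG]|d F G eqFG _ [c IH]].
- by exists (fun=> c) => x y; rewrite big_ord1 !mulr1.
- exists (fun i => (if i is i'.+1 then e * c i' else 0) + (if (i < d.+1)%N then f * c i else 0)).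
  move=> x y; under eq_bigr => i _ do rewrite !mulrDl.
  rewrite big_split /= big_ord_recl [X in _ = _ + X]big_ord_recr /= ltnn.
  rewrite !mul0r add0r addr0.
  rewrite mulrDl !IH !mulr_sumr; congr (_ + _); apply: eq_bigr => i _.
    by rewrite /bump /= exprS; ring.
  by rewrite ltn_ord subSn ?exprS; [ring | rewrite -ltnS].
- exists (fun i => c i + c' i) => x y; rewrite IHF IHG -big_split; apply: eq_bigr => i _ /=.
  by ring.
- by exists c => x y; rewrite -eqFG.
Qed.

(** The even period polynomials of weight 12. In the usual presentation these
    are killed by 1 + S and by 1 + U + U^2, where S and U have orders 2 and 3
    in PSL_2(Z); for polynomials even in each variable, this amounts to
    period_anti and period_three. *)
Record period (P : int -> int -> int) : Prop := Period {
  period_even : forall x y, P (- x) y = P x y;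
  period_anti : forall x y, P y x = - P x y;
  period_three : forall x y, P x y = P (x + y) y + P x (x + y);
  period_homog : homog 10 P }.

Lemma period_evenr P x y : period P -> P x (- y) = P x y.
Proof. by move=> PP; rewrite (period_anti PP) (period_even PP) -(period_anti PP). Qed.

Fixpoint euclid_rec (P : int -> int -> int) (n : nat) (a b x y : int) : int :=
  if n is n'.+1 then
    if b == 0 then 0 else
    let x' := x - (a %/ b)%Z * y in
    P x' y + euclid_rec P n' (- b) (a %% b)%Z y (- x')
  else 0.

(** The value at (x, y) of the modular symbol of P along the path from the
    cusp (1, 0) to the cusp (a, b). The recursion uses (a, b) = T^q (r, b)
    and (r, b) = S (b, - r), with q and r the quotient and remainder of a by
    b: invariance under T removes q, and the path to S (b, - r) is the path
    from (1, 0) to S (1, 0) = (0, 1), which contributes P, followed by the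
    image under S of the path to (b, - r). *)
Definition eichler P (a b x y : int) : int :=
  if b < 0 then euclid_rec P `|b|.+1 (- a) (- b) x y else euclid_rec P `|b|.+1 a b x y.

Lemma euclid_rec_fuel P n m a b x y : 0 <= b -> (`|b| < n)%N -> (`|b| < m)%N ->
  euclid_rec P n a b x y = euclid_rec P m a b x y.
Proof.
elim: n m a b x y => [|n IHn] [|m] a b x y // b0 ltbn ltbm /=.
case: eqP => // /eqP bn0; congr (_ + _).
have r0 := modz_ge0 a bn0; have := ltz_mod a bn0.
by move=> ltr; apply: IHn => //; lia.
Qed.

Lemma eichler0 P a x y : eichler P a 0 x y = 0.
Proof. by []. Qed.

Lemma eichlerE P a b x y : 0 < b ->
  eichler P a b x y =
  P (x - (a %/ b)%Z * y) y + eichler P (- b) (a %% b)%Z y (- (x - (a %/ b)%Z * y)).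
Proof.
move=> b0; have bn0 : b != 0 by lia.
have r0 := modz_ge0 a bn0; have ltr := ltz_mod a bn0.
have nonneg a' b' x' y' : 0 <= b' -> eichler P a' b' x' y' = euclid_rec P `|b'|.+1 a' b' x' y'.
  by rewrite /eichler ltNge => ->.
rewrite !nonneg ?(ltW b0) // [LHS]/= (negPf bn0); congr (_ + _).
by apply: euclid_rec_fuel => //; lia.
Qed.

Lemma eichlerN P a b x y : eichler P (- a) (- b) x y = eichler P a b x y.
Proof.
rewrite /eichler abszN !opprK; case: (ltgtP b 0) => [b0|b0|->].
- by rewrite ltNge (_ : 0 <= - b) //; lia.
- by rewrite (_ : - b < 0) //; lia.
- by rewrite oppr0 ltxx.
Qed.

Lemma eichlerMD P q a b x y : eichler P (q * b + a) b x y = eichler P a b (x - q * y) y.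
Proof.
have pos a' b' x' y' : 0 < b' ->
    eichler P (q * b' + a') b' x' y' = eichler P a' b' (x' - q * y') y'.
  move=> b0; have bn0 : b' != 0 by lia.
  rewrite [LHS]eichlerE // [RHS]eichlerE // modzMDl divzMDl //.
  have -> : x' - (q + (a' %/ b')%Z) * y' = x' - q * y' - (a' %/ b')%Z * y' by ring.
  by [].
case: (ltgtP b 0) => [b0|b0|->]; last by rewrite !eichler0.
- by rewrite -eichlerN -[RHS]eichlerN opprD -mulrN; apply: pos; lia.
- exact: pos.
Qed.

Lemma eichlerDE P a' a b x y : a' = a + b -> eichler P a' b x y = eichler P a b (x - y) y.
Proof. by move->; rewrite -[b in a + b]mul1r addrC eichlerMD mul1r. Qed.

Lemma eichler_opp P a b x y : period P -> eichler P a b (- x) (- y) = eichler P a b x y.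
Proof.
move=> PP.
have Popp u v : P (- u) (- v) = P u v.
  by rewrite (period_even PP) (period_anti PP) (period_even PP) -(period_anti PP).
have pos n a' b' x' y' : 0 <= b' -> (`|b'| < n)%N ->
    eichler P a' b' (- x') (- y') = eichler P a' b' x' y'.
  elim: n a' b' x' y' => // n IHn a' b' x' y' b0 ltbn.
  case: (eqVneq b' 0) => [->|bn0]; first by rewrite !eichler0.
  have r0 := modz_ge0 a' bn0; have ltr := ltz_mod a' bn0.
  rewrite [LHS]eichlerE ?[RHS]eichlerE; [|lia..].
  have -> : - x' - (a' %/ b')%Z * - y' = - (x' - (a' %/ b')%Z * y') by ring.
  by rewrite Popp IHn //; lia.
case: (lerP 0 b) => [b0|b0]; first exact: (pos `|b|.+1).
by rewrite -eichlerN -[RHS]eichlerN; apply: (pos `|b|.+1) => //; lia.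
Qed.

Lemma eichler_small P a b x y : 0 <= a -> a < b ->
  eichler P a b x y = P x y + eichler P (- b) a y (- x).
Proof.
move=> a0 ltab; have b0 : 0 < b by lia.
have lt_ab : 0 <= a < `|b| by rewrite a0; lia.
rewrite eichlerE // divz_small // modz_small ?a0 // mul0r subr0 //.
Qed.

(** Invariance under S in the case that carries the content. If a < b, it is the
    definition of the cocycle. If a > b, two steps of the recursion reduce it
    to (a - b, b), and the leftover terms in P are the three-term relation. *)
Lemma eichlerS_pos P a b x y : period P -> 0 < a -> 0 < b ->
  eichler P (- b) a x y = eichler P a b y (- x) + P x y.
Proof.
move=> PP; have [n] := ubnP `|a|; elim: n => // n IHn in a b x y * => lt_an a0 b0.
have P_swap u v : P v (- u) = - P u v.
  by rewrite (period_anti PP) (period_even PP).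
case: (ltgtP a b) => [lt_ab|lt_ba|eq_ab].
- rewrite [eichler P a b _ _]eichler_small ?(ltW a0) // P_swap eichler_opp //.
  by rewrite addrAC addNr add0r.
- have -> : eichler P (- b) a x y = eichler P (a - b) a (x + y) y.
    by rewrite [RHS](@eichlerDE _ _ (- b)) ?addrK // addrC.
  rewrite eichler_small; [|lia|lia].
  have -> : eichler P (- a) (a - b) y (- (x + y)) = eichler P (- b) (a - b) (- x) (- (x + y)).
    rewrite [RHS](@eichlerDE _ _ (- a)); last by ring.
    by congr (eichler _ _ _ _ _); ring.
  rewrite IHn; [|lia..]; rewrite opprK.
  have -> : eichler P (a - b) b (- (x + y)) x = eichler P a b (- y) x.
    rewrite [RHS](@eichlerDE _ _ (a - b)) ?subrK //; congr (eichler _ _ _ _ _); ring.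
  rewrite -[eichler P a b y _]eichler_opp // opprK [P x y](period_three PP) (period_even PP).
  rewrite (period_evenr _ _ PP).
  by ring.
- rewrite {a lt_an a0}eq_ab.
  have eichler0b u v : eichler P 0 b u v = P u v.
    by rewrite eichler_small // eichler0 addr0.
  have -> : eichler P (- b) b x y = P (x + y) y.
    by rewrite -eichler0b [RHS](@eichlerDE _ _ (- b)) ?addrK // addNr.
  rewrite (@eichlerDE _ b 0) ?add0r // eichler0b [P x y](period_three PP).
  rewrite opprK [y + x]addrC (period_evenr _ _ PP) [P (x + y) x](period_anti PP).
  by ring.
Qed.

Lemma eichlerS P a b x y : period P -> (a != 0) || (b != 0) ->
  eichler P (- b) a x y = eichler P a b y (- x) + P x y.
Proof.
move=> PP ab0; have P_swap u v : P v (- u) = - P u v.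
  by rewrite (period_anti PP) (period_even PP).
have eichler0b c u v : c != 0 -> eichler P 0 c u v = P u v.
  move=> c0; case: (ltgtP c 0) => [?|?|eqc]; last by rewrite eqc in c0.
    by rewrite -eichlerN oppr0 eichler_small ?eichler0 ?addr0 //; lia.
  by rewrite eichler_small ?eichler0 ?addr0.
have apos c d u v : 0 < c -> eichler P (- d) c u v = eichler P c d v (- u) + P u v.
  move=> c0; case: (ltgtP d 0) => [d0|d0|->].
  - rewrite -[eichler P c d v _]eichlerN [eichler P (- c) _ _ _]eichlerS_pos //; [|lia].
    by rewrite P_swap eichler_opp //; ring.
  - exact: eichlerS_pos.
  - by rewrite oppr0 eichler0 eichler0b ?add0r //; lia.
case: (ltgtP a 0) => [a0|a0|eqa]; last first.
- move: ab0; rewrite eqa eqxx /= => b0.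
  by rewrite eichler0 eichler0b // P_swap addNr.
- exact: apos.
- by rewrite -eichlerN apos ?eichlerN //; lia.
Qed.

(** Invariance under the reflection diag(-1, 1). *)
Lemma eichlerR P a b x y : period P -> eichler P (- a) b (- x) y = eichler P a b x y.
Proof.
move=> PP.
have pos n c d u v : (`|d| < n)%N -> 0 < d ->
    eichler P (- c) d (- u) v = eichler P c d u v.
  elim: n => // n IHn in c d u v * => lt_dn d0; have dn0 : d != 0 by lia.
  rewrite (divz_eq c d) opprD -mulNr [LHS]eichlerMD [RHS]eichlerMD.
  rewrite (_ : - u - _ = - (u - (c %/ d)%Z * v)); last by ring.
  move: (u - _) => {}u; have r0 := modz_ge0 c dn0; have := ltz_mod c dn0.
  move: (c %% d)%Z r0 => r r0 ltrd.
  have [->|rn0] := eqVneq r 0.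
    by rewrite oppr0 [LHS]eichler_small // [RHS]eichler_small // !eichler0 (period_even PP).
  rewrite eichlerS_pos //; [|lia].
  rewrite [RHS]eichler_small //; [|lia]; rewrite opprK (period_even PP) addrC.
  by congr (_ + _); rewrite -{2}[v]opprK IHn ?eichler_opp //; lia.
case: (ltgtP b 0) => [b0|b0|->]; last by rewrite !eichler0.
- by rewrite -eichlerN -[RHS]eichlerN (pos `|b|.+1) //; lia.
- exact: (pos `|b|.+1).
Qed.

Lemma eichlerZ P t a b x y : t != 0 -> eichler P (t * a) (t * b) x y = eichler P a b x y.
Proof.
have pos n s c d u v : (`|d| < n)%N -> 0 < s -> 0 <= d ->
    eichler P (s * c) (s * d) u v = eichler P c d u v.
  elim: n => // n IHn in c d u v * => lt_dn s0 d0.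
  have [->|dn0] := eqVneq d 0; first by rewrite mulr0 !eichler0.
  rewrite [LHS]eichlerE ?[RHS]eichlerE; [|nia|lia].
  rewrite divzMpl // -mulz_modr //; congr (_ + _).
  have := modz_ge0 c dn0; have := ltz_mod c dn0 => ? ?.
  by rewrite -mulrN IHn //; lia.
have pos' s c d u v : 0 < s -> eichler P (s * c) (s * d) u v = eichler P c d u v.
  move=> s0; case: (lerP 0 d) => d0; first exact: (pos `|d|.+1).
  by rewrite -eichlerN -!mulrN (pos `|d|.+1) ?eichlerN //; lia.
move=> t0; case: (ltgtP t 0) => [?|?|eqt]; last by rewrite eqt in t0.
- by rewrite -eichlerN -!mulNr pos' //; lia.
- exact: pos'.
Qed.

Lemma homog_eichler P a b : period P -> homog 10 (eichler P a b).
Proof.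
move=> PP; have homog0 : homog 10 (fun _ _ => 0).
  by apply: homog_ext (homog_mulc 0 (period_homog PP)) => x y; rewrite mul0r.
have pos n c d : (`|d| < n)%N -> 0 <= d -> homog 10 (eichler P c d).
  elim: n => // n IHn in c d * => lt_dn d0.
  have [->|dn0] := eqVneq d 0; first by apply: homog_ext homog0.
  have := modz_ge0 c dn0; have := ltz_mod c dn0 => ? ?.
  have IH : homog 10 (eichler P (- d) (c %% d)%Z) by apply: IHn => //; lia.
  pose q := (c %/ d)%Z.
  apply: homog_ext (homog_add (homog_comp 1 (- q) 0 1 (period_homog PP))
                              (homog_comp 0 1 (-1) q IH)) => x y.
  rewrite [RHS]eichlerE; last by lia.
  by congr (P _ _ + eichler _ _ _ _ _); rewrite /q; ring.
case: (lerP 0 b) => b0; first exact: (pos `|b|.+1).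
apply: (@homog_ext _ (eichler P (- a) (- b))); first by move=> x y; rewrite eichlerN.
by apply: (pos `|b|.+1) => //; lia.
Qed.

(** * Modular symbols *)

Definition vec := (int * int)%type.

Definition act (a b c d : int) (v : vec) : vec :=
  (a * v.1 + b * v.2, c * v.1 + d * v.2).

(** The action of the matrix (a b; c d) on the three arguments. *)
Definition pull (f : vec -> vec -> vec -> int) (a b c d : int) (u v x : vec) : int :=
  f (act a b c d u) (act a b c d v) (act a b c d x).

Definition nz (v : vec) : bool := (v.1 != 0) || (v.2 != 0).

(** Invariance is required only for T, S and the reflection R, which generate
    GL_2(Z). The vectors u and v stand for cusps, so they matter up to a
    scalar (ms_proj); the zero vector is no cusp, hence the guards in ms_S. *)
Record modsym (f : vec -> vec -> vec -> int) : Prop := ModSym {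
  ms_add : forall u v w x, f u v x + f v w x = f u w x;
  ms_T : forall u v x, pull f 1 1 0 1 u v x = f u v x;
  ms_S : forall u v x, nz u -> nz v -> pull f 0 (-1) 1 0 u v x = f u v x;
  ms_R : forall u v x, pull f (-1) 0 0 1 u v x = f u v x;
  ms_proj : forall t u v x, t != 0 -> f (act t 0 0 t u) v x = f u v x;
  ms_homog : forall u v, homog 10 (fun x y => f u v (x, y)) }.

Lemma act_comp a b c d a' b' c' d' v :
  act a b c d (act a' b' c' d' v) =
  act (a * a' + b * c') (a * b' + b * d') (c * a' + d * c') (c * b' + d * d') v.
Proof. by rewrite /act /=; congr (_, _); ring. Qed.

Lemma pull_comp f a b c d a' b' c' d' u v x :
  pull f a b c d (act a' b' c' d' u) (act a' b' c' d' v) (act a' b' c' d' x) =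
  pull f (a * a' + b * c') (a * b' + b * d') (c * a' + d * c') (c * b' + d * d') u v x.
Proof. by rewrite /pull !act_comp. Qed.

Lemma act_nz a b c d v : a * d - b * c != 0 -> nz v -> nz (act a b c d v).
Proof.
case: v => x y det0; rewrite /nz /act /=; apply: contraTT; rewrite !negb_or !negbK.
case/andP=> /eqP eq1 /eqP eq2.
have /eqP : (a * d - b * c) * x = 0.
  rewrite (_ : _ * x = d * (a * x + b * y) - b * (c * x + d * y)); last by ring.
  by rewrite eq1 eq2 !mulr0 subr0.
have /eqP : (a * d - b * c) * y = 0.
  rewrite (_ : _ * y = a * (c * x + d * y) - c * (a * x + b * y)); last by ring.
  by rewrite eq1 eq2 !mulr0 subr0.
by rewrite !mulf_eq0 (negPf det0) /= => -> ->.
Qed.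

Definition symbol P (u v x : vec) : int :=
  eichler P v.1 v.2 x.1 x.2 - eichler P u.1 u.2 x.1 x.2.

Lemma modsym_symbol P : period P -> modsym (symbol P).
Proof.
move=> PP; split; rewrite /symbol.
- by move=> *; ring.
- move=> [u1 u2] [v1 v2] [x y]; rewrite /pull /act /= !mul1r !mul0r !add0r.
  by rewrite !(@eichlerDE _ (_ + _) _ _ _ _ erefl) addrK.
- move=> [u1 u2] [v1 v2] [x y]; rewrite /pull /act /nz /= => nzu nzv.
  rewrite !mul0r !mulN1r !mul1r !add0r !addr0 !eichlerS // opprK.
  by ring.
- move=> [u1 u2] [v1 v2] [x y]; rewrite /pull /act /=.
  by rewrite !mul0r !mulN1r !mul1r !add0r !addr0 !eichlerR.
- move=> t [u1 u2] [v1 v2] [x y] t0; rewrite /act /=.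
  by rewrite !mul0r !add0r !addr0 eichlerZ.
- move=> [u1 u2] [v1 v2] /=.
  apply: homog_ext (homog_add (homog_eichler v1 v2 PP)
                     (homog_mulc (-1) (homog_eichler u1 u2 PP))) => x y.
  by rewrite mulN1r.
Qed.

Lemma ms_same f u x : modsym f -> f u u x = 0.
Proof. by move=> mf; have := ms_add mf u u u x; lia. Qed.

Lemma ms_antisym f u v x : modsym f -> f v u x = - f u v x.
Proof. by move=> mf; have := ms_add mf u v u x; rewrite ms_same //; lia. Qed.

Lemma ms_projr f t u v x : modsym f -> t != 0 -> f u (act t 0 0 t v) x = f u v x.
Proof. by move=> mf t0; rewrite ms_antisym // ms_proj // -ms_antisym. Qed.

Lemma ms_scalar f t u v x : modsym f -> t != 0 -> pull f t 0 0 t u v x = t ^+ 10 * f u v x.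
Proof.
move=> mf t0; rewrite /pull ms_proj // ms_projr //; case: x => x y.
rewrite /act /= !mul0r addr0 add0r.
exact: (@homog_scale _ (fun x y => f u v (x, y)) t x y (ms_homog mf u v)).
Qed.

Lemma act1 v : act 1 0 0 1 v = v.
Proof. by case: v => x y; rewrite /act /= !mul1r !mul0r addr0 add0r. Qed.

Lemma ms_Tn f n u v x : modsym f -> pull f 1 n 0 1 u v x = f u v x.
Proof.
move=> mf.
have step m : pull f 1 (m + 1) 0 1 u v x = pull f 1 m 0 1 u v x.
  rewrite -[RHS](ms_T mf) pull_comp.
  by congr pull; ring.
elim/int_rect: n => [|n IHn|n IHn].
- by rewrite /pull !act1.
- by rewrite -[n.+1]addn1 PoszD step.
- by rewrite -IHn -[LHS]step; congr pull; lia.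
Qed.

(** Euclid on the first column: the rows of (a b; c d) are exchanged by S, and
    a is reduced modulo c by a power of T. *)
Lemma ms_SL2 f a b c d u v x : modsym f -> a * d - b * c = 1 -> nz u -> nz v ->
  pull f a b c d u v x = f u v x.
Proof.
move=> mf; have [n] := ubnP `|c|; elim: n => // n IHn in a b c d * => lt_cn det1 nzu nzv.
have [c0|cn0] := eqVneq c 0.
  have [[a1 d1]|[a1 d1]] : (a = 1 /\ d = 1) \/ (a = -1 /\ d = -1).
    move: det1; rewrite c0 mulr0 subr0 => ad1.
    have /eqP : (`|a| * `|d|)%N = 1%N by rewrite -abszM ad1.
    by rewrite muln_eq1 => /andP[/eqP a1 /eqP d1]; nia.
    by rewrite c0 a1 d1 ms_Tn.
  rewrite c0 a1 d1 (_ : pull _ _ _ _ _ _ _ _ = pull f (-1) 0 0 (-1)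
    (act 1 (-b) 0 1 u) (act 1 (-b) 0 1 v) (act 1 (-b) 0 1 x)).
    by rewrite ms_scalar // mul1r [LHS]ms_Tn.
  by rewrite pull_comp; congr pull; ring.
pose q := (a %/ c)%Z; pose r := (a %% c)%Z.
have def_a : a = q * c + r := divz_eq a c.
have lt_rc := ltz_mod a cn0; have r0 := modz_ge0 a cn0.
have det1' : c * - (b - q * d) - d * - r = 1 by rewrite -det1 def_a; ring.
rewrite -(IHn c d (- r) (- (b - q * d))) //; last by rewrite -/r in lt_rc r0 *; lia.
rewrite [RHS]/pull -[RHS](ms_S mf); [|by apply: act_nz => //; rewrite det1'..].
rewrite -[RHS](ms_Tn q _ _ _ mf) /pull !act_comp.
by congr (f (act _ _ _ _ _) (act _ _ _ _ _) (act _ _ _ _ _)); rewrite ?def_a; ring.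
Qed.

Definition e1 : vec := (1, 0).
Definition e2 : vec := (0, 1).

(** Every path is a sum of images of the path from e1 to e2 (Manin's continued
    fraction trick), so a symbol that vanishes there vanishes everywhere. *)
Lemma ms_eq0 f u v x : modsym f -> (forall y, f e1 e2 y = 0) -> nz u -> nz v -> f u v x = 0.
Proof.
move=> mf f0.
suff fv w y : nz w -> f e1 w y = 0.
  by move=> nzu nzv; rewrite -(ms_add mf u e1 v) [f u e1 x]ms_antisym // !fv ?oppr0.
case: w => a b; have [n] := ubnP `|b|; elim: n => // n IHn in a b y * => lt_bn nzw.
have [b0|bn0] := eqVneq b 0.
  have a0 : a != 0 by move: nzw; rewrite /nz b0 eqxx orbF.
  have -> : (a, b) = act a 0 0 a e1 by rewrite b0 /act /=; congr (_, _); ring.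
  by rewrite ms_projr // ms_same.
pose q := (a %/ b)%Z; pose r := (a %% b)%Z.
have def_a : a = q * b + r := divz_eq a b.
have lt_rb := ltz_mod a bn0; have r0 := modz_ge0 a bn0; rewrite -/r in lt_rb r0.
have nz' : nz (b, - r) by rewrite /nz /= bn0.
have eqf : f e1 (a, b) y = f e1 (r, b) (act 1 (- q) 0 1 y).
  rewrite -(ms_Tn (- q) _ _ _ mf); congr (f _ _ _).
    by rewrite /act /=; congr (_, _); ring.
  by rewrite /act /= def_a; congr (_, _); ring.
rewrite eqf -(ms_add mf _ e2) f0 add0r; move: (act _ _ _ _ y) => z.
rewrite -(IHn b (- r) (act 0 1 (-1) 0 z)) //; last by lia.
rewrite -[RHS](ms_S mf) // /pull /act /e1 /e2 /= (surjective_pairing z).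
by congr (f (_, _) (_, _) (_, _)); rewrite /=; ring.
Qed.

(** * Hecke operators *)

(** The sum runs over the Hermite normal forms (n/d b; 0 d), 0 <= b < d, of the
    integer matrices of determinant n up to SL_2(Z) on the left. *)
Definition hecke (n : nat) (f : vec -> vec -> vec -> int) (u v x : vec) : int :=
  \sum_(d <- divisors n) \sum_(0 <= b < d) pull f (n %/ d)%N b 0 d u v x.

Lemma divisors_prime p : prime p -> perm_eq (divisors p) [:: 1%N; p].
Proof.
move=> p_pr; have p1 := prime_gt1 p_pr; apply: uniq_perm.
- exact: divisors_uniq.
- by rewrite /= inE neq_ltn p1.
move=> d; rewrite -dvdn_divisors ?prime_gt0 // !inE; apply/idP/idP.
  by have [_] := primeP p_pr; apply.
by case/orP=> /eqP->.
Qed.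

Lemma hecke_prime p f u v x : prime p ->
  hecke p f u v x = pull f p 0 0 1 u v x + \sum_(0 <= j < p) pull f 1 j 0 p u v x.
Proof.
move=> p_pr; rewrite /hecke (perm_big _ (divisors_prime p_pr)) big_cons !big_seq1.
by rewrite divn1 divnn prime_gt0.
Qed.

Lemma sum_blocks (R : nmodType) p d (F : nat -> R) :
  \sum_(0 <= b < d) \sum_(0 <= j < p) F (b + j * d)%N = \sum_(0 <= b < p * d) F b.
Proof.
rewrite exchange_big /=; elim: p => [|p IHp]; first by rewrite !big_geq.
rewrite big_nat_recr //= IHp mulSnr [RHS](@big_cat_nat _ _ _ (p * d)) ?leq_addr //=.
by congr (_ + _); rewrite -[in RHS](add0n (p * d)%N) big_addn !add0n addKn.
Qed.

Lemma periodic_modn (R : Type) d (F : nat -> R) b :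
  (forall b, F (b + d)%N = F b) -> F (b %% d)%N = F b.
Proof.
move=> Fd; rewrite [in RHS](divn_eq b d) addnC.
by elim: (b %/ d)%N => [|q IHq]; rewrite ?addn0 // mulSn addnCA addnC Fd.
Qed.

(** Multiplication by p permutes the residues modulo d. *)
Lemma sum_periodic_mul (R : nmodType) p d (F : nat -> R) :
  coprime p d -> (forall b, F (b + d)%N = F b) ->
  \sum_(0 <= b < d) F (p * b)%N = \sum_(0 <= b < d) F b.
Proof.
move=> co_pd Fd; pose s := iota 0 d.
have Us : uniq [seq (p * b %% d)%N | b <- s].
  rewrite map_inj_in_uniq ?iota_uniq // => b b'; rewrite !mem_iota /= !add0n => ltb ltb'.
  wlog le_bb' : b b' ltb ltb' / (b' <= b)%N => [H|].
    by case/orP: (leq_total b b') => le_bb' eq_bb'; [apply/esym|]; apply: H.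
  move/eqP; rewrite eqn_mod_dvd ?leq_mul2l ?le_bb' ?orbT // -mulnBr.
  rewrite Gauss_dvdr 1?coprime_sym // => /dvdn_leq.
  by case: (posnP (b - b')) => [|_ /(_ isT)]; lia.
have sub_s : {subset [seq (p * b %% d)%N | b <- s] <= s}.
  move=> c /mapP[b]; rewrite !mem_iota /= !add0n => ltb ->.
  by rewrite ltn_mod; lia.
(* An injection of a finite set into itself is onto. *)
have [_ eq_s] := uniq_min_size Us sub_s (eq_leq (esym (size_map _ _))).
rewrite /index_iota subn0 -/s -[RHS](perm_big _ (uniq_perm Us (iota_uniq 0 d) eq_s)) /=.
by rewrite big_map; apply: eq_bigr => b _; rewrite (periodic_modn _ Fd).
Qed.

(** The combinatorial core of hecke_hecke, where G a b d stands for the value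
    at the matrix (a b; 0 d). Multiplying the Hermite forms of determinant n by
    those of determinant p gives (a, b + j d; 0, p d), which are the Hermite
    forms (a, *; 0, d') of determinant p n with p dividing d', and
    (p a, p b; 0, d). When p does not divide d, p b runs over the residues
    modulo d, and one gets the other Hermite forms of determinant p n. When p
    divides d, the matrix is p times a Hermite form of determinant n / p, each
    one being reached p times: this is the origin of p^11 = p * p^10. *)
Lemma hecke_sum n p (G : nat -> nat -> nat -> int) :
    prime p -> (0 < n)%N ->
    (forall a b d, G a (b + d)%N d = G a b d) ->
    (forall a b d, G (p * a)%N (p * b)%N (p * d)%N = p%:Z ^+ 10 * G a b d) ->
  \sum_(d <- divisors n) \sum_(0 <= b < d)
     (G (p * (n %/ d))%N (p * b)%N d + \sum_(0 <= j < p) G (n %/ d)%N (b + j * d)%N (p * d)%N)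
  = \sum_(d <- divisors (p * n)) \sum_(0 <= b < d) G (p * n %/ d)%N b d
    + (if (p %| n)%N then
         p%:Z ^+ 11 * \sum_(d <- divisors (n %/ p)) \sum_(0 <= b < d) G (n %/ p %/ d)%N b d
       else 0).
Proof.
move=> p_pr n0 Gper Gscale; have p0 := prime_gt0 p_pr.
have pn0 : (0 < p * n)%N by rewrite muln_gt0 p0.
rewrite [\sum_(d <- divisors (p * n)) _](bigID (fun d => p %| d)%N) /= -addrA.
under eq_bigr => d _ do
  rewrite big_split /= (sum_blocks p d (fun c => G (n %/ d)%N c (p * d)%N)).
rewrite big_split /= addrC; congr (_ + _).
  pose H d := \sum_(0 <= b < d) G (p * n %/ d)%N b d.
  rewrite -[RHS](@reindex_seq _ _ _ (divisors n) _ predT _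
    (fun d => p * d)%N (fun d => d %/ p)%N H) ?divisors_uniq //.
  - by apply: eq_bigr => d _; rewrite /H divnMl.
  - move=> d; rewrite -!dvdn_divisors // => dn _.
    by rewrite dvdn_pmul2l // dn dvdn_mulr // mulKn.
  - move=> d; rewrite -!dvdn_divisors // => dn /dvdnP[e def_d].
    move: dn; rewrite def_d mulnC dvdn_pmul2l // mulKn // => ->.
rewrite (bigID (fun d => p %| d)%N) /= addrC; congr (_ + _).
  pose H d := \sum_(0 <= b < d) G (p * n %/ d)%N b d.
  rewrite -[RHS](@reindex_seq _ _ _ (divisors n) _ (fun d => ~~ (p %| d))%N _
    id id H) ?divisors_uniq //.
  - rewrite [LHS]big_seq_cond [RHS]big_seq_cond; apply: eq_bigr => d /andP[].
    rewrite -dvdn_divisors // => dn pd.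
    rewrite /= /H -muln_divA //.
    apply: (@sum_periodic_mul _ p d (fun b => G (p * (n %/ d))%N b d)) => //.
    by rewrite prime_coprime.
  - by move=> d; rewrite -!dvdn_divisors // => dn pd; rewrite dvdn_mull.
  - move=> d; rewrite -!dvdn_divisors // => dn pd; split=> //.
    by rewrite -(@Gauss_dvdr _ p) // coprime_sym prime_coprime.
case: ifPn => [pn|pn]; last first.
  rewrite big_seq_cond big1 // => d /andP[]; rewrite -dvdn_divisors // => dn pd.
  by rewrite (dvdn_trans pd dn) in pn.
have np0 : (0 < n %/ p)%N by rewrite divn_gt0 // dvdn_leq.
(* The d that p divides are the p d' with d' dividing n / p. *)
pose K d := \sum_(0 <= b < d) G (p * (n %/ d))%N (p * b)%N d.
rewrite -[LHS](@reindex_seq _ _ _ (divisors (n %/ p)) _ predT _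
  (fun d => p * d)%N (fun d => d %/ p)%N K) ?divisors_uniq //; first last.
- move=> d; rewrite -!dvdn_divisors // => dn /dvdnP[e def_d].
  move: dn; rewrite def_d mulnC mulKn // dvdn_divRL // mulnC => ->; split=> //.
- move=> d; rewrite -!dvdn_divisors // dvdn_divRL // mulnC => dn _.
  by rewrite dn dvdn_mulr // mulKn.
rewrite mulr_sumr; apply: eq_bigr => d _; rewrite /K divnMA.
under [LHS]eq_bigr => b _ do rewrite Gscale.
rewrite -mulr_sumr [p%:Z ^+ 11]exprSr -mulrA; congr (_ * _).
rewrite -(sum_blocks p d (fun c => G (n %/ p %/ d)%N c d)) mulr_sumr; apply: eq_bigr => b _.
have Gj j : G (n %/ p %/ d)%N (b + j * d)%N d = G (n %/ p %/ d)%N b d.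
  by elim: j => [|j IHj]; rewrite ?addn0 // mulSnr addnA Gper.
under eq_bigr => j _ do rewrite Gj.
by rewrite sumr_const_nat subn0 -mulr_natl natz.
Qed.

Lemma pull_add f a b c d u v w x : modsym f ->
  pull f a b c d u v x + pull f a b c d v w x = pull f a b c d u w x.
Proof. by move=> mf; exact: (ms_add mf). Qed.

Lemma hecke_hecke n p f u v x : modsym f -> prime p -> (0 < n)%N ->
  hecke n (hecke p f) u v x =
  hecke (p * n) f u v x + (if (p %| n)%N then p%:Z ^+ 11 * hecke (n %/ p) f u v x else 0).
Proof.
move=> mf p_pr n0; have p0 := prime_gt0 p_pr.
rewrite -(@hecke_sum n p (fun a b d => pull f a b 0 d u v x)) //.
- apply: eq_bigr => d _; apply: eq_bigr => b _; rewrite [LHS]/pull hecke_prime //.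
  rewrite pull_comp; congr (_ + _); first by rewrite !PoszM; congr pull; ring.
  apply: eq_bigr => j _; rewrite pull_comp; congr pull; rewrite ?PoszM ?PoszD ?PoszM; ring.
- move=> a b d; rewrite -[RHS](ms_T mf) pull_comp PoszD; congr pull; ring.
- move=> a b d; rewrite -(ms_scalar _ _ _ mf) ?eqz_nat -?lt0n // pull_comp !PoszM.
  by congr pull; ring.
Qed.

Lemma sum_shift1 (p : nat) (F : int -> int) : F p = F 0 ->
  \sum_(0 <= j < p) F (j%:Z + 1) = \sum_(0 <= j < p) F j%:Z.
Proof.
case: p => [|p] Fp; first by rewrite !big_geq.
rewrite big_nat_recr // big_nat_recl //= addrC -[p%:Z + 1]PoszD addn1 Fp; congr (_ + _).
by apply: eq_bigr => j _; rewrite -PoszD addn1.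
Qed.

Lemma sum_opp (p : nat) (F : int -> int) : (forall j, F (j + p%:Z) = F j) ->
  \sum_(0 <= j < p) F (- j%:Z) = \sum_(0 <= j < p) F j%:Z.
Proof.
move=> Fp; rewrite -sum_shift1 ?add0r; last by rewrite -[p%:Z]add0r Fp.
rewrite big_nat_rev /=; apply: eq_big_nat => j lt_jp.
by rewrite -Fp; congr F; lia.
Qed.

(** The residue j' in [1, p - 1] with j j' = - 1 modulo p. *)
Definition neg_inverse (p j : nat) : nat := p - (egcdn j p).1 %% p.

Lemma neg_inverseP p j : prime p -> (0 < j < p)%N ->
  (0 < neg_inverse p j < p)%N /\ (p %| j * neg_inverse p j + 1)%N.
Proof.
move=> p_pr /andP[j0 ltjp]; rewrite /neg_inverse.
have co_jp : coprime j p.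
  by rewrite coprime_sym prime_coprime //; apply/negP=> /dvdn_leq; lia.
case: (egcdnP p j0) => k k' eq_bezout _ /=; rewrite (eqP co_jp) in eq_bezout.
have p1 := prime_gt1 p_pr; have ltr := ltn_pmod k (ltnW p1).
have k0 : (0 < k %% p)%N.
  rewrite lt0n; apply/negP=> /dvdnP[q def_k].
  have : (p %| 1)%N.
    rewrite -(dvdn_addr _ (dvdn_mull k' (dvdnn p))) -eq_bezout def_k.
    by rewrite mulnAC dvdn_mull.
  by rewrite dvdn1; lia.
split; first lia.
rewrite -(dvdn_addr _ (dvdn_mull k' (dvdnn p))); move: (divn_eq k p) => def_k.
rewrite (_ : _ + _ = (j + j * (k %/ p)) * p)%N ?dvdn_mull //.
by move: (k %% p)%N (k %/ p)%N ltr def_k => r q ltr def_k; nia.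
Qed.

Lemma neg_inverseK p j : prime p -> (0 < j < p)%N -> neg_inverse p (neg_inverse p j) = j.
Proof.
move=> p_pr jp; have [jp' dvd1] := neg_inverseP p_pr jp.
have [jp'' dvd2] := neg_inverseP p_pr jp'.
set i := neg_inverse p j in jp' dvd1 dvd2 jp'' *; set k := neg_inverse p i in jp'' dvd2 *.
clearbody k; clearbody i.
have co_pi : coprime p i.
  rewrite prime_coprime //; apply/negP=> /dvdn_leq; lia.
have : (k == j %[mod p])%N.
  wlog le_jk : j k jp jp' jp'' dvd1 dvd2 / (j <= k)%N => [H|].
    case/orP: (leq_total j k) => le; first exact: H.
    by rewrite eq_sym; apply: H => //; rewrite mulnC.
  rewrite eqn_mod_dvd // -(Gauss_dvdr _ co_pi).
  have -> : (i * (k - j) = (i * k + 1) - (j * i + 1))%N by nia.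
  by rewrite dvdn_sub.
by rewrite !modn_small; [move/eqP|lia|lia].
Qed.

Lemma nz_e1 : nz e1. Proof. by []. Qed.
Lemma nz_e2 : nz e2. Proof. by []. Qed.

(** Invariance holds because right multiplication by T, S or R permutes the
    Hermite forms of determinant p up to left multiplication by elements of
    GL_2(Z). For S, the forms diag(p, 1) and diag(1, p) are exchanged, and
      (1 j; 0 p) S = (j, - m; p, - j') (1 j'; 0 p)   with m p = j j' + 1. *)
Lemma modsym_hecke f p : modsym f -> prime p -> modsym (hecke p f).
Proof.
move=> mf p_pr; have p0 := prime_gt0 p_pr; have p0z : p%:Z != 0 by rewrite eqz_nat -lt0n.
have Fp_mul u v x j : pull f 1 (j + p%:Z) 0 p u v x = pull f 1 j 0 p u v x.
  by rewrite -[RHS](ms_T mf) pull_comp; congr pull; ring.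
split.
- move=> u v w x; rewrite !hecke_prime // addrACA -big_split /=.
  by congr (_ + _); [|apply: eq_bigr => j _]; apply: pull_add.
- move=> u v x; rewrite {1}/pull !hecke_prime // pull_comp; congr (_ + _).
    by rewrite -[RHS](ms_Tn p _ _ _ mf) pull_comp; congr pull; ring.
  rewrite -[RHS](@sum_shift1 p (fun j => pull f 1 j 0 p u v x));
    last by rewrite -[p%:Z]add0r Fp_mul.
  by apply: eq_bigr => j _; rewrite pull_comp; congr pull; ring.
- move=> u v x nzu nzv; rewrite {1}/pull !hecke_prime //.
  have nzB a b c d w : nz w -> a * d - b * c != 0 -> nz (act a b c d w).
    by move=> *; apply: act_nz.
  rewrite !(@big_ltn _ _ _ 0 p) // !pull_comp addrCA; congr (_ + (_ + _)).
  + rewrite -[RHS](ms_S mf) ?pull_comp; last 2 first.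
    * by apply: act_nz => //; rewrite mulr1 mul0r subr0.
    * by apply: act_nz => //; rewrite mulr1 mul0r subr0.
    by congr pull; ring.
  + rewrite -[RHS](ms_S mf) ?pull_comp; last 2 first.
    * by apply: act_nz => //; rewrite mul1r mul0r subr0.
    * by apply: act_nz => //; rewrite mul1r mul0r subr0.
    by congr pull; ring.
  apply/esym.
  rewrite -[LHS](@reindex_seq _ _ _ (index_iota 1 p) _ predT _
    (neg_inverse p) (neg_inverse p) (fun j => pull f 1 j%:Z 0 p u v x)); rewrite ?iota_uniq //.
  + apply: eq_big_nat => j jp.
    have [jp' /dvdnP[m def_m]] := neg_inverseP p_pr jp; rewrite pull_comp.
    set i := neg_inverse p j in jp' def_m *.
    have def_mz : j%:Z * i%:Z + 1 = m%:Z * p%:Z by rewrite -!PoszM -def_m PoszD.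
    rewrite [LHS]/pull -[LHS](@ms_SL2 f j (- m%:Z) p (- i%:Z)) //; last 3 first.
    * by rewrite mulrN mulNr opprK -def_mz; ring.
    * by apply: nzB => //; rewrite mul1r mulr0 subr0.
    * by apply: nzB => //; rewrite mul1r mulr0 subr0.
    rewrite pull_comp; congr pull; rewrite ?mulNr -?def_mz; ring.
  + move=> j; rewrite mem_index_iota => jp _; have [jp' _] := neg_inverseP p_pr jp.
    by rewrite mem_index_iota jp' neg_inverseK.
  + move=> j; rewrite mem_index_iota => jp _; have [jp' _] := neg_inverseP p_pr jp.
    by rewrite mem_index_iota jp' neg_inverseK.
- move=> u v x; rewrite {1}/pull !hecke_prime // pull_comp; congr (_ + _).
    by rewrite -[RHS](ms_R mf) pull_comp; congr pull; ring.
  rewrite -[RHS](@sum_opp p (fun j => pull f 1 j 0 p u v x)) //.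
  apply: eq_bigr => j _; rewrite pull_comp -[RHS](ms_R mf) pull_comp; congr pull; ring.
- move=> t u v x t0; rewrite !hecke_prime //; congr (_ + _).
    rewrite /pull act_comp -[RHS](ms_proj mf _ _ _ t0) act_comp.
    by congr (f (act _ _ _ _ u) _ _); ring.
  apply: eq_bigr => j _.
  rewrite /pull act_comp -[RHS](ms_proj mf _ _ _ t0) act_comp.
  by congr (f (act _ _ _ _ u) _ _); ring.
- move=> u v.
  have homog_pull a b c d : homog 10 (fun x y => pull f a b c d u v (x, y)).
    exact: (homog_comp a b c d (ms_homog mf _ _)).
  have homog_sum n : homog 10 (fun x y => pull f p 0 0 1 u v (x, y)
      + \sum_(0 <= j < n) pull f 1 j 0 p u v (x, y)).
    elim: n => [|n IHn].
      by apply: homog_ext (homog_pull p 0 0 1) => x y; rewrite big_geq // addr0.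
    apply: homog_ext (homog_add IHn (homog_pull 1 n 0 p)) => x y.
    by rewrite big_nat_recr //= addrA.
  by apply: homog_ext (homog_sum p) => x y; rewrite hecke_prime.
Qed.

(** * Even period polynomials of weight 12 *)

Definition even12 (x y : int) : int :=
  x ^+ 8 * y ^+ 2 - 3 * x ^+ 6 * y ^+ 4 + 3 * x ^+ 4 * y ^+ 6 - x ^+ 2 * y ^+ 8.

Definition eis12 (x y : int) : int := x ^+ 10 - y ^+ 10.

(** Up to a scalar, the even period polynomial of Delta. *)
Definition delta12 (x y : int) : int := 691 * even12 x y - 36 * eis12 x y.

Lemma homog_monomial i j : homog (i + j) (fun x y => x ^+ i * y ^+ j).
Proof.
elim: i => [|i IHi] /=.
  elim: j => [|j IHj]; first by apply: homog_ext (homog_const 1) => x y; rewrite mulr1.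
  by apply: homog_ext (homog_lin 0 1 IHj) => x y; rewrite exprS; ring.
by rewrite addSn; apply: homog_ext (homog_lin 1 0 IHi) => x y; rewrite exprS; ring.
Qed.

Lemma period_even12 : period even12.
Proof.
split; rewrite /even12; [move=> x y; ring..|].
apply: homog_ext (homog_add (homog_add (homog_monomial 8 2)
    (homog_mulc (-3) (homog_monomial 6 4)))
  (homog_add (homog_mulc 3 (homog_monomial 4 6)) (homog_mulc (-1) (homog_monomial 2 8)))) => x y.
by ring.
Qed.

Lemma period_eis12 : period eis12.
Proof.
split; rewrite /eis12; [move=> x y; ring..|].
apply: homog_ext (homog_add (homog_monomial 10 0) (homog_mulc (-1) (homog_monomial 0 10))) => x y.
by ring.
Qed.

Lemma period_lin P Q s t : period P -> period Q -> period (fun x y => s * P x y + t * Q x y).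
Proof.
move=> PP PQ; split.
- by move=> x y; rewrite (period_even PP) (period_even PQ).
- by move=> x y; rewrite (period_anti PP) (period_anti PQ); ring.
- by move=> x y; rewrite [P x y](period_three PP) [Q x y](period_three PQ); ring.
- by apply: homog_add; apply: homog_mulc; apply: period_homog.
Qed.

Lemma period_ext P Q : (forall x y, P x y = Q x y) -> period P -> period Q.
Proof.
move=> eqPQ PP; split.
- by move=> x y; rewrite -!eqPQ (period_even PP).
- by move=> x y; rewrite -!eqPQ (period_anti PP).
- by move=> x y; rewrite -!eqPQ (period_three PP).
- exact: homog_ext eqPQ (period_homog PP).
Qed.

Lemma period_delta12 : period delta12.
Proof.
apply: period_ext (period_lin 691 (-36) period_even12 period_eis12) => x y.
by rewrite /delta12 mulNr.
Qed.

(** A form of degree 10 has 11 coefficients; the relations are imposed by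
    evaluating at small integers, which leaves two free coefficients. *)
Lemma period_span F : period F ->
  exists a b : int, forall x y, F x y = a * even12 x y + b * eis12 x y.
Proof.
move=> PF; have [c Fc] := homog_coef (period_homog PF).
have Fxy x y : F x y = c 0 * y ^+ 10 + c 1 * x * y ^+ 9 + c 2 * x ^+ 2 * y ^+ 8
    + c 3 * x ^+ 3 * y ^+ 7 + c 4 * x ^+ 4 * y ^+ 6 + c 5 * x ^+ 5 * y ^+ 5
    + c 6 * x ^+ 6 * y ^+ 4 + c 7 * x ^+ 7 * y ^+ 3 + c 8 * x ^+ 8 * y ^+ 2
    + c 9 * x ^+ 9 * y + c 10 * x ^+ 10.
  by rewrite Fc !big_ord_recr big_ord0 /=; ring.
(* Horner form keeps the numbers small when evaluating at 1, ..., 5. *)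
have odd0 x : x * (c 1 + x * x * (c 3 + x * x * (c 5 + x * x * (c 7 + x * x * c 9)))) = 0.
  apply: (@mulfI _ 2) => //; rewrite mulr0.
  rewrite -[RHS](subrr (F x 1)) -{2}(period_even PF) !Fxy; ring.
have [c1 c3 c5 c7 c9] : [/\ c 1 = 0, c 3 = 0, c 5 = 0, c 7 = 0 & c 9 = 0].
  have h1 := odd0 1; have h2 := odd0 2; have h3 := odd0 3; have h4 := odd0 4.
  by have h5 := odd0 5; clear -h1 h2 h3 h4 h5; split; lia.
have anti x : c 0 + c 10 + x * x * (c 2 + c 8 + x * x * (c 4 + c 6 + x * x * (c 6 + c 4
    + x * x * (c 8 + c 2 + x * x * (c 10 + c 0))))) = 0.
  by rewrite -[RHS](addNr (F x 1)) -(period_anti PF) !Fxy c1 c3 c5 c7 c9; ring.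
have [c0 c2 c4] : [/\ c 0 = - c 10, c 2 = - c 8 & c 4 = - c 6].
  have h0 := anti 0; have h1 := anti 1; have h2 := anti 2; clear -h0 h1 h2.
  by split; lia.
have c6 : c 6 = - 3 * c 8.
  (* The three-term relation at (2, 1), once the other coefficients are eliminated. *)
  have : 60 * 98 * (c 6 + 3 * c 8) = F 2 1 - (F (2 + 1) 1 + F 2 (2 + 1)).
    by rewrite !Fxy c0 c1 c2 c3 c4 c5 c7 c9; ring.
  rewrite [F 2 1](period_three PF) subrr => /eqP; rewrite mulf_eq0 => /orP[//|/eqP].
  by clear; lia.
exists (c 8), (c 10) => x y; rewrite Fxy c0 c1 c2 c3 c4 c5 c6 c7 c9 /even12 /eis12.
by ring.
Qed.

Lemma modsym_lin f g s t : modsym f -> modsym g ->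
  modsym (fun u v x => s * f u v x + t * g u v x).
Proof.
move=> mf mg; split.
- by move=> u v w x; rewrite -(ms_add mf u v w) -(ms_add mg u v w); ring.
- by move=> u v x; rewrite /pull -[in RHS](ms_T mf) -[in RHS](ms_T mg).
- by move=> u v x nzu nzv; rewrite /pull -[in RHS](ms_S mf) // -[in RHS](ms_S mg).
- by move=> u v x; rewrite /pull -[in RHS](ms_R mf) -[in RHS](ms_R mg).
- by move=> c u v x c0; rewrite (ms_proj mf) // (ms_proj mg).
- by move=> u v; apply: homog_add; apply: homog_mulc; apply: ms_homog.
Qed.

(** Two symbols with the same period are equal, by ms_eq0 for their
    difference. *)
Lemma ms_e12 f g : modsym f -> modsym g -> (forall x, f e1 e2 x = g e1 e2 x) ->
  forall u v x, nz u -> nz v -> f u v x = g u v x.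
Proof.
move=> mf mg eqfg u v x nzu nzv.
have := @ms_eq0 _ u v x (modsym_lin 1 (-1) mf mg) _ nzu nzv.
by rewrite mul1r mulN1r => /(_ _)/subr0_eq; apply=> y; rewrite eqfg; ring.
Qed.

(** S exchanges the two ends of the path from e1 to e2, and this path is the
    path from e1 to (1, 1) followed by that from (1, 1) to e2; both pieces are
    images of the path from e1 to e2 under unipotent matrices. *)
Lemma period_modsym f : modsym f -> period (fun x y => f e1 e2 (x, y)).
Proof.
move=> mf.
have even x y : f e1 e2 (- x, y) = f e1 e2 (x, y).
  rewrite -[RHS](ms_R mf) /pull -[LHS](@ms_proj _ mf (-1)) //.
  by congr (f (_, _) (_, _) (_, _)); rewrite /=; ring.
have anti x y : f e1 e2 (y, x) = - f e1 e2 (x, y).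
  rewrite -[f e1 e2 (x, y)](ms_S mf) // /pull -(ms_antisym _ _ _ mf).
  rewrite -[LHS]even -[LHS](@ms_proj _ mf (-1)) // /act /=.
  by congr (f (_, _) (_, _) (_, _)); ring.
have evenr x y : f e1 e2 (x, - y) = f e1 e2 (x, y).
  by rewrite [LHS]anti [f _ _ (- y, x)]even [in RHS]anti.
split=> //; last exact: ms_homog.
move=> x y; rewrite -[LHS]evenr -[LHS](ms_add mf _ (1, 1)); congr (_ + _).
- rewrite -[RHS]evenr -[RHS](ms_T mf) /pull /act /=.
  by congr (f (_, _) (_, _) (_, _)); ring.
- rewrite -[RHS]evenr -[RHS](@ms_SL2 f 1 0 1 1) // /pull /act /=.
  by congr (f (_, _) (_, _) (_, _)); ring.
Qed.

Lemma symbol_e12 P x y : period P -> symbol P e1 e2 (x, y) = P x y.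
Proof.
move=> PP; rewrite /symbol /= eichler0 subr0 eichler_small // eichler0 addr0.
by [].
Qed.

(** * The second Hecke operator and linearity *)

(** The Hermite forms of determinant 2 are diag(2, 1), diag(1, 2) and
    (1 1; 0 2). Only the last one sends the path from e1 to e2 to a path with
    two pieces, from (1, 0) to (0, 1) and from (0, 1) to (1, 2). *)
Lemma hecke2_symbol P x y : period P ->
  hecke 2 (symbol P) e1 e2 (x, y) =
  P (2 * x) y + P x (2 * y) + P (x + y) (2 * y) + P (2 * x) (x + y).
Proof.
move=> PP; rewrite hecke_prime // /index_iota /= big_cons big_seq1 /pull /act /symbol /=.
transitivity (eichler P 0 1 (2 * x) y - eichler P 2 0 (2 * x) y
  + (eichler P 0 2 x (2 * y) - eichler P 1 0 x (2 * y)
  + (eichler P 1 2 (x + y) (2 * y) - eichler P 1 0 (x + y) (2 * y)))).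
  by congr (eichler _ _ _ _ _ - eichler _ _ _ _ _ + (eichler _ _ _ _ _ -
     eichler _ _ _ _ _ + (eichler _ _ _ _ _ - eichler _ _ _ _ _))); ring.
have eichler01 u v : eichler P 0 1 u v = P u v by rewrite eichler_small // eichler0 addr0.
have -> : eichler P 1 2 (x + y) (2 * y) = P (x + y) (2 * y) + P (2 * x) (x + y).
  rewrite eichler_small //; congr (_ + _).
  rewrite (_ : eichler P _ _ _ _ = eichler P (-2 * 1 + 0) 1 (2 * y) (- (x + y))) //.
  rewrite eichlerMD eichler01 (period_evenr _ _ PP) -(period_even PP).
  by congr P; ring.
rewrite !eichler0 eichler01 [eichler P 0 2 _ _]eichler_small // eichler0.
by ring.
Qed.

Lemma hecke_eq n f g u v x : (0 < n)%N ->
  (forall u v x, nz u -> nz v -> f u v x = g u v x) -> nz u -> nz v ->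
  hecke n f u v x = hecke n g u v x.
Proof.
move=> n0 eqfg nzu nzv; apply: eq_big_seq => d; rewrite -dvdn_divisors // => dn.
apply: eq_bigr => b _; apply: eqfg; apply: act_nz => //.
all: rewrite mulr0 subr0 mulf_neq0 //.
all: have := dvdn_gt0 n0 dn; have := divn_gt0 n (dvdn_gt0 n0 dn); have := dvdn_leq n0 dn; lia.
Qed.

Lemma hecke_lin n f g s t u v x :
  hecke n (fun u v x => s * f u v x + t * g u v x) u v x =
  s * hecke n f u v x + t * hecke n g u v x.
Proof.
rewrite /hecke !mulr_sumr -big_split; apply: eq_bigr => d _ /=.
by rewrite !mulr_sumr -big_split.
Qed.

(** * The Hecke operators at the period of Delta *)

(** The coefficients of corr12 and prod12 solve the linear system expressed by
    corr12_right and corr12_left. The ratio of 2 * 1200 to 84 * 63 in prod12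
    is that of the two convolutions in E4 E8 - E6^2; it forces the ratio of 691
    to - 36 in delta12. *)
Definition corr12 (x y : int) : int :=
  36 * y ^+ 10 - 841 * x ^+ 2 * y ^+ 8 + 600 * x ^+ 3 * y ^+ 7 + 2255 * x ^+ 4 * y ^+ 6
  - 2646 * x ^+ 5 * y ^+ 5 + 182 * x ^+ 6 * y ^+ 4 + 600 * x ^+ 7 * y ^+ 3
  - 150 * x ^+ 8 * y ^+ 2.

Definition prod12 (x y : int) : int :=
  1200 * (x ^+ 3 * y ^+ 7) + 1200 * (x ^+ 7 * y ^+ 3) - 84 * 63 * (x ^+ 5 * y ^+ 5).

Lemma corr12_right x y : corr12 x y - corr12 (x + y) y = prod12 x y.
Proof. by rewrite /corr12 /prod12; ring. Qed.

Lemma corr12_left x y :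
  delta12 y (x + y) + corr12 x y - corr12 x (x + y) = prod12 x y.
Proof. by rewrite /corr12 /prod12 /delta12 /even12 /eis12; ring. Qed.

Lemma sum_corr12 N : (0 < N)%N ->
  \sum_(1 <= a < N) corr12 a%:Z N%:Z =
  10 * N%:Z ^+ 7 + 5 * N%:Z ^+ 3 + 21 * N%:Z ^+ 5 - 36 * N%:Z ^+ 10.
Proof.
move=> N0; apply: (@mulfI _ 6) => //; rewrite mulr_sumr.
rewrite (@sum_antidifference (fun x => 6 * corr12 x N%:Z) (fun x => (fun N y : int =>
  - 216 * y ^+ 10 + 30 * N * y ^+ 2 + 26 * N * y ^+ 4 - 451 * N * y ^+ 6
  - 841 * N * y ^+ 8 + 216 * N * y ^+ 10 + 300 * N ^+ 2 * y ^+ 3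
  + 1323 * N ^+ 2 * y ^+ 5 + 900 * N ^+ 2 * y ^+ 7 + 2523 * N ^+ 2 * y ^+ 8
  - 200 * N ^+ 3 * y ^+ 2 - 182 * N ^+ 3 * y ^+ 4 + 4510 * N ^+ 3 * y ^+ 6
  - 1800 * N ^+ 3 * y ^+ 7 - 1682 * N ^+ 3 * y ^+ 8 - 1050 * N ^+ 4 * y ^+ 3
  - 6615 * N ^+ 4 * y ^+ 5 - 6765 * N ^+ 4 * y ^+ 6 + 900 * N ^+ 4 * y ^+ 7
  + 420 * N ^+ 5 * y ^+ 2 + 546 * N ^+ 5 * y ^+ 4 + 7938 * N ^+ 5 * y ^+ 5
  + 2706 * N ^+ 5 * y ^+ 6 + 2100 * N ^+ 6 * y ^+ 3 - 546 * N ^+ 6 * y ^+ 4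
  - 2646 * N ^+ 6 * y ^+ 5 - 600 * N ^+ 7 * y ^+ 2 - 1800 * N ^+ 7 * y ^+ 3
  + 156 * N ^+ 7 * y ^+ 4 + 450 * N ^+ 8 * y ^+ 2 + 450 * N ^+ 8 * y ^+ 3
  - 100 * N ^+ 9 * y ^+ 2) x N%:Z)) //; rewrite /corr12.
- by ring.
- by ring.
- by move=> x; ring.
Qed.

(** Telescoping with k = f (-c, d) e1 (a, b) + h (a, b). The Euclidean step on
    (a, b, c, d) is the action of a unipotent matrix on (-c, d) and (a, b).
    When d < c this matrix fixes e1, so the first summand is invariant; when
    c < d it sends (1, -1) to e1, and the first summand changes by the value on
    the path from (1, -1) to e1, which is a period of f. The hypotheses on h
    say that P is the total change in both cases. On the diagonal a = b = m,
    the first summand is, up to the period f e1 e2 (m, 0), minus a term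
    f e1 (c, N) (m, 0) of the sum defining the Hecke operator. *)
Lemma hecke_quad_sum f (h P : int -> int -> int) n :
    modsym f -> (0 < n)%N ->
    (forall x y, h x y - h (x + y) y = P x y) ->
    (forall x y, f e1 e2 (y, x + y) + h x y - h x (x + y) = P x y) ->
    (forall x, h x x = - f e1 e2 (x, 0)) ->
  hecke n f e1 e2 e1 =
  - \sum_(q <- quads n) P q.1.1%:Z q.1.2%:Z
  - \sum_(N <- divisors n) \sum_(1 <= a < N) h a%:Z N%:Z
  + \sum_(N <- divisors n) f e1 e2 (N%:Z, 0).
Proof.
move=> mf n0 h_right h_left h_diag.
have f_edge a b : f (1, -1) e1 (a, b) = f e1 e2 (b, a + b).
  rewrite -[RHS](period_even (period_modsym mf)).
  rewrite -[RHS](@ms_SL2 f 1 1 (-1) 0) // /pull /act /=.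
  by congr (f (_, _) (_, _) (_, _)); ring.
pose k (a b c d : nat) := f (- c%:Z, d%:Z) e1 (a%:Z, b%:Z) + h a b.
rewrite (@quad_sum_telescope n k (fun a b => P a b)) //; first last.
- move=> a b c d /and4P[a0 b0 d0 lt_dc]; rewrite /k.
  have -> : f (- (c - d)%N%:Z, d%:Z) e1 ((a + b)%N%:Z, b%:Z)
          = f (- c%:Z, d%:Z) e1 (a%:Z, b%:Z).
    rewrite -[RHS](ms_T mf) /pull /act /=.
    have -> : (c - d)%N%:Z = c%:Z - d%:Z by lia.
    by congr (f (_, _) (_, _) (_, _)); rewrite ?PoszD; ring.
  by rewrite -h_right PoszD; ring.
- move=> a b c d /and4P[a0 b0 c0 lt_cd]; rewrite /k.
  have -> : f (- c%:Z, (d - c)%N%:Z) e1 (a%:Z, (a + b)%N%:Z)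
          = f (- c%:Z, d%:Z) (1, -1) (a%:Z, b%:Z).
    rewrite -[RHS](@ms_SL2 f 1 0 1 1) //; last by rewrite /nz /=; lia.
    rewrite /pull /act /=.
    have -> : (d - c)%N%:Z = d%:Z - c%:Z by lia.
    by congr (f (_, _) (_, _) (_, _)); rewrite ?PoszD; ring.
  rewrite -h_left -f_edge -(ms_add mf (- c%:Z, d%:Z) (1, -1) e1) PoszD; ring.
set A := \sum_(N <- divisors n) \sum_(1 <= a < N) (_ - _).
set B := \sum_(N <- divisors n) \sum_(1 <= c < N) _.
have -> : A = - \sum_(N <- divisors n) \sum_(1 <= a < N) h a%:Z N%:Z.
  rewrite -sumrN; apply: eq_big_seq => N; rewrite -dvdn_divisors // => Nn.
  have N0 := dvdn_gt0 n0 Nn; have m0 : (0 < n %/ N)%N by rewrite divn_gt0 // dvdn_leq.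
  rewrite -sumrN; apply: eq_big_nat => a aN; rewrite /k.
  have -> : f (- (n %/ N)%N%:Z, (n %/ N)%N%:Z) e1 (a%:Z, (N - a)%N%:Z)
          = f (1, -1) e1 (a%:Z, (N - a)%N%:Z).
    rewrite -[RHS](@ms_proj _ mf (- (n %/ N)%N%:Z)); last by lia.
    by rewrite /act /=; congr (f (_, _) _ _); ring.
  rewrite f_edge -h_left -PoszD subnKC; [by ring|lia].
have -> : B = - hecke n f e1 e2 e1 + \sum_(N <- divisors n) f e1 e2 (N%:Z, 0).
  rewrite -(sum_divisors_swap (fun d => f e1 e2 (d%:Z, 0))) //.
  rewrite /hecke -sumrN -big_split /=; apply: eq_big_seq => N; rewrite -dvdn_divisors // => Nn.
  have N0 := dvdn_gt0 n0 Nn; have m0 : (0 < n %/ N)%N by rewrite divn_gt0 // dvdn_leq.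
  move: (n %/ N)%N m0 => m m0; have m0z : m%:Z != 0 by lia.
  have pull_e12 b : pull f m b 0 N e1 e2 e1 = f e1 (b, N%:Z) (m%:Z, 0).
    rewrite -[RHS](ms_proj mf _ _ _ m0z) /pull /act /=.
    by congr (f (_, _) (_, _) (_, _)); ring.
  have f_0N : f e1 (0, N%:Z) (m%:Z, 0) = f e1 e2 (m%:Z, 0).
    rewrite -[RHS](@ms_projr _ N%:Z) //; last by lia.
    by rewrite /act /=; congr (f _ (_, _) _); ring.
  have f_reflect c : f e1 (- c, N%:Z) (m%:Z, 0) = f e1 (c, N%:Z) (m%:Z, 0).
    rewrite -[LHS](ms_R mf) -[RHS](@ms_projr _ (-1)) // -[RHS]mul1r.
    rewrite -[RHS](@ms_scalar f (-1)) // /pull /act /=.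
    by congr (f (_, _) (_, _) (_, _)); ring.
  have f_diag : f e1 (1, -1) (m%:Z, 0) = f e1 e2 (m%:Z, 0).
    rewrite -[LHS](@ms_projr _ (-1)) // -[LHS](ms_T mf) /pull /act /=.
    by congr (f (_, _) (_, _) (_, _)); ring.
  transitivity (- \sum_(1 <= c < N) f e1 (c%:Z, N%:Z) (m%:Z, 0)); last first.
    rewrite [in RHS]big_ltn // pull_e12 f_0N.
    under [in RHS]eq_bigr => c _ do rewrite pull_e12.
    by rewrite opprD addrAC addNr add0r.
  rewrite -sumrN; apply: eq_big_nat => c cN; rewrite /k.
  have -> : f (- c%:Z, (N - c)%N%:Z) e1 (m%:Z, m%:Z) = f (- c%:Z, N%:Z) (1, -1) (m%:Z, 0).
    rewrite -[LHS](@ms_SL2 f 1 0 (-1) 1) //; last by rewrite /nz /=; lia.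
    have -> : (N - c)%N%:Z = N%:Z - c%:Z by lia.
    by rewrite /pull /act /=; congr (f (_, _) (_, _) (_, _)); ring.
  rewrite h_diag -f_diag -(ms_add mf e1 (- c%:Z, N%:Z)) f_reflect.
  by rewrite opprD addrCA subrr addr0.
by ring.
Qed.

(** The divisor sums left by hecke_quad_sum are those of E4 E8 - E6^2, with
    opposite sign and divided by 48; those of sigma 10 cancel. *)
Lemma hecke_delta12_tau n : (0 < n)%N ->
  hecke n (symbol delta12) e1 e2 e1 = - 36 * tau n.
Proof.
move=> n0; rewrite (hecke_quad_sum (modsym_symbol period_delta12) n0 corr12_right); first last.
- by move=> x; rewrite (symbol_e12 _ _ period_delta12) /corr12 /delta12 /even12 /eis12; ring.
- by move=> x y; rewrite (symbol_e12 _ _ period_delta12) corr12_left.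
have -> : \sum_(N <- divisors n) symbol delta12 e1 e2 (N%:Z, 0) = - 36 * sigma 10 n.
  rewrite /sigma mulr_sumr; apply: eq_bigr => N _.
  by rewrite (symbol_e12 _ _ period_delta12) /delta12 /even12 /eis12; ring.
have -> : \sum_(N <- divisors n) \sum_(1 <= a < N) corr12 a%:Z N%:Z =
    10 * sigma 7 n + 5 * sigma 3 n + 21 * sigma 5 n - 36 * sigma 10 n.
  rewrite /sigma !mulr_sumr -!big_split -sumrB /=; apply: eq_big_seq => N.
  by rewrite -dvdn_divisors // => Nn; rewrite sum_corr12 // (dvdn_gt0 n0 Nn).
rewrite sumrB big_split /= -!mulr_sumr !sigma_convolution (sigma_convolutionC n 7 3).
set c37 := \sum_(1 <= m < n) _ * _; set c55 := \sum_(1 <= m < n) _ * _.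
have := tau_eisenstein n0; rewrite -/c37 -/c55 => eq_tau.
apply: (@mulfI _ 48) => //.
rewrite (_ : 48 * (- 36 * tau n) = - (1728 * tau n)); last by ring.
by rewrite eq_tau; ring.
Qed.

(** Write a F + b E for the image of D in the basis F, E. Commutation with the
    second Hecke operator gives 36 a + 691 b = 0, and evaluation at e1 gives
    b = - 36 tau p. *)
Lemma hecke_delta12_eigen p u v x : prime p -> nz u -> nz v ->
  hecke p (symbol delta12) u v x = tau p * symbol delta12 u v x.
Proof.
set D := symbol delta12; set F := symbol even12; set E := symbol eis12.
have mD : modsym D := modsym_symbol period_delta12.
have mF : modsym F := modsym_symbol period_even12.
have mE : modsym E := modsym_symbol period_eis12.
have D_FE u' v' x' : nz u' -> nz v' -> D u' v' x' = 691 * F u' v' x' + (- 36) * E u' v' x'.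
  apply: (ms_e12 mD (modsym_lin _ _ mF mE)) => -[a b].
  rewrite /D /F /E !symbol_e12 ?mulNr //.
  - exact: period_eis12.
  - exact: period_even12.
  - exact: period_delta12.
have hecke2E u' v' x' : nz u' -> nz v' -> hecke 2 E u' v' x' = 2049 * E u' v' x' + 0 * E u' v' x'.
  apply: (ms_e12 (modsym_hecke mE _) (modsym_lin _ _ mE mE)) => // -[a b].
  rewrite /E hecke2_symbol ?symbol_e12; [|exact: period_eis12..].
  by rewrite /eis12; ring.
have hecke2D u' v' x' : nz u' -> nz v' -> hecke 2 D u' v' x' = - 24 * D u' v' x' + 0 * D u' v' x'.
  apply: (ms_e12 (modsym_hecke mD _) (modsym_lin _ _ mD mD)) => // -[a b].
  rewrite /D hecke2_symbol ?symbol_e12; [|exact: period_delta12..].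
  by rewrite /delta12 /even12 /eis12; ring.
have D11 : D e1 e2 e1 = - 36.
  by rewrite /D (symbol_e12 _ _ period_delta12).
move=> p_pr nzu nzv; have p0 := prime_gt0 p_pr.
(* For p = 2 the eigenvalue - 24 is explicit, and it is tau 2 by evaluation at e1. *)
have [p2|p_odd] := eqVneq p 2.
  have := hecke_delta12_tau (ltnW (ltnSn 1)); rewrite p2 -/D !hecke2D // D11.
  by move=> eq_tau2; rewrite (_ : tau 2 = - 24) ?mul0r ?addr0 //; lia.
have mpD := modsym_hecke mD p_pr.
have [a [b eq_ab]] := period_span (period_modsym mpD).
have hecke_pD u' v' x' : nz u' -> nz v' -> hecke p D u' v' x' = a * F u' v' x' + b * E u' v' x'.
  apply: (ms_e12 mpD (modsym_lin _ _ mF mE)) => -[s t]; rewrite eq_ab /F /E.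
  by rewrite !symbol_e12; [|exact: period_eis12|exact: period_even12].
have F11 : F e1 e2 e1 = 0 by rewrite /F (symbol_e12 _ _ period_even12).
have E11 : E e1 e2 e1 = 1 by rewrite /E (symbol_e12 _ _ period_eis12).
have hecke2F : hecke 2 F e1 e2 e1 = 108.
  have := @hecke_eq 2 _ _ e1 e2 e1 isT D_FE nz_e1 nz_e2.
  rewrite hecke_lin hecke2D // hecke2E // D11 E11.
  by move: (hecke 2 F e1 e2 e1) => h; lia.
have hecke_p11 : b = - 36 * tau p.
  by rewrite -(hecke_delta12_tau p0) hecke_pD // F11 E11; ring.
have p_ndvd2 : (p %| 2)%N = false by rewrite dvdn_prime2 // (negPf p_odd).
have two_ndvdp : (2 %| p)%N = false by rewrite dvdn_prime2 // eq_sym (negPf p_odd).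
have := @hecke_hecke 2 p D e1 e2 e1 mD p_pr isT.
rewrite p_ndvd2 addr0 mulnC.
have := @hecke_hecke p 2 D e1 e2 e1 mD isT p0.
rewrite two_ndvdp addr0 => <-.
rewrite (hecke_eq e1 p0 hecke2D nz_e1 nz_e2) hecke_lin.
rewrite (hecke_eq e1 (isT : (0 < 2)%N) hecke_pD nz_e1 nz_e2) hecke_lin.
rewrite hecke2F hecke2E // hecke_pD // F11 E11.
move=> eq_comm; have eq_a : a = 691 * tau p by lia.
by rewrite hecke_pD // D_FE // hecke_p11 eq_a; ring.
Qed.

(** * Mordell's relation and the theorem *)

(** Evaluate hecke n (hecke p D) at e1, using that D is an eigenvector for the
    inner operator. *)
Lemma tau_hecke n p : prime p -> (0 < n)%N ->
  tau p * tau n = tau (p * n) + (if (p %| n)%N then p%:Z ^+ 11 * tau (n %/ p) else 0).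
Proof.
move=> p_pr n0; have p0 := prime_gt0 p_pr; set D := symbol delta12.
have mD : modsym D := modsym_symbol period_delta12.
have := @hecke_hecke n p D e1 e2 e1 mD p_pr n0.
have hecke_pD u v x : nz u -> nz v -> hecke p D u v x = tau p * D u v x + 0 * D u v x.
  by move=> nzu nzv; rewrite hecke_delta12_eigen // mul0r addr0.
rewrite (hecke_eq e1 n0 hecke_pD nz_e1 nz_e2) hecke_lin mul0r addr0.
rewrite [hecke n _ _ _ _]hecke_delta12_tau //.
rewrite [hecke (p * n) _ _ _ _]hecke_delta12_tau; last by rewrite muln_gt0 p0.
move=> eq_h; apply: (@mulfI _ (- 36)) => //.
rewrite (_ : - 36 * (tau p * tau n) = tau p * (- 36 * tau n)); last by ring.
rewrite eq_h mulrDr; congr (_ + _); case: ifP => [pn|]; last by rewrite mulr0.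
have np0 : (0 < n %/ p)%N by rewrite divn_gt0 // dvdn_leq.
by rewrite (hecke_delta12_tau np0); ring.
Qed.

Lemma tau1 : tau 1 = 1.
Proof.
apply: (@mulfI _ (- 36)) => //; rewrite -hecke_delta12_tau // mulr1.
rewrite /hecke big_seq1 /index_iota /= big_seq1 /pull /act /=.
by rewrite (symbol_e12 _ _ period_delta12).
Qed.

Lemma tau_prime4 p : prime p ->
  tau (p ^ 4) = (tau p ^+ 2) ^+ 2 - 3 * tau p ^+ 2 * p%:Z ^+ 11 + (p%:Z ^+ 11) ^+ 2.
Proof.
move=> p_pr; have p0 := prime_gt0 p_pr.
have step k : tau (p ^ k.+2) = tau p * tau (p ^ k.+1) - p%:Z ^+ 11 * tau (p ^ k).
  rewrite tau_hecke ?expn_gt0 ?p0 // -expnS ifT; last by rewrite expnS dvdn_mulr.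
  by rewrite [in (_ %/ p)%N]expnS mulKn // addrK.
by rewrite !step expn0 expn1 tau1; ring.
Qed.

Theorem theorem1p3 (p : nat) (hp : prime p) (l : nat) (hl : prime l)
    (hdvd : (l%:Z %| tau (p ^ 4))%Z) :
  l = p \/ l = 0 %[mod 5] \/ l = 1 %[mod 5] \/ l = 4 %[mod 5].
Proof.
have [->|l_neq_p] := eqVneq l p; [by left | right].
apply: (@dvd_quadratic_form_mod5 l (tau p ^+ 2) (p%:Z ^+ 11)) => //.
  rewrite dvdzE abszX /= Euclid_dvdX // andbT dvdn_prime2 //.
by rewrite -tau_prime4.
Qed.
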